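(* Let $R$ be a unital associative ring, let $(M_i)_i$ be a family of left $R$-modules and let $M = \bigoplus_i M_i$ be the corresponding direct sum. Then $\mathrm{PGF\text{-}dim}_R M = \sup_i \mathrm{PGF\text{-}dim}_R M_i$ (in $\mathbb{N} \cup \{\infty\}$). In particular, the class $\overline{\mathtt{PGF}}(R)$ of modules of finite PGF-dimension is closed under finite direct sums and direct summands.
   Context: $R$ is a unital associative ring; modules are left $R$-modules. A PGF-module (projectively coresolved Gorenstein flat module) is a syzygy (i.e. a kernel of some differential) of an acyclic ($\mathbb{Z}$-indexed) complex $P_*$ of projective modules such that the complex $I \otimes_R P_*$ is acyclic for every injective right $R$-module $I$; $\mathtt{PGF}(R)$ is the class of PGF-modules. For a module $M$, $\mathrm{PGF\text{-}dim}_R M$ is the least non-negative integer $n$ for which there is an exact sequence $0 \to G_n \to \cdots \to G_0 \to M \to 0$ with all $G_i \in \mathtt{PGF}(R)$, and $\mathrm{PGF\text{-}dim}_R M = \infty$ if no such $n$ exists. $\overline{\mathtt{PGF}}(R)$ is the class of all modules $M$ with $\mathrm{PGF\text{-}dim}_R M < \infty$. *)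

(* Defs.v *)
From HB Require Import structures.
From mathcomp Require Import all_boot all_order all_algebra.
From mathcomp Require Import boolp classical_sets functions cardinality.
From mathcomp Require Import freeg.

Set Implicit Arguments.
Unset Strict Implicit.
Unset Printing Implicit Defensive.

Import GRing.Theory.

Local Open Scope ring_scope.
Local Open Scope quotient_scope.

Inductive enat := Fin of nat | Infty.

Definition le_enat (x y : enat) : Prop :=
  match x, y with
  | _, Infty => True
  | Infty, Fin _ => False
  | Fin m, Fin n => (m <= n)%N
  end.

Definition least (P : nat -> Prop) : enat :=
  if pselect (exists n, `[< P n >]) is left exP then Fin (ex_minn exP)
  else Infty.

Lemma le_least (P : nat -> Prop) :
  (forall m n, (m <= n)%N -> P m -> P n) ->
  forall n, le_enat (least P) (Fin n) <-> P n.
Proof.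
move=> Pmono n; rewrite /least; case: pselect => [exP|nexP] /=; last first.
  by split=> // Pn; case: nexP; exists n; apply/asboolP.
case: ex_minnP => m /asboolP Pm minm; split=> [/Pmono|Pn]; first exact.
by apply: minm; apply/asboolP.
Qed.

(* Since N \cup {oo} is N with a top element added, the supremum of a family is
   its least natural upper bound, or oo when there is none. *)
Definition enat_sup (I : Type) (f : I -> enat) : enat :=
  least (fun n => forall i, le_enat (f i) (Fin n)).

Lemma enat_sup_lub (I : Type) (f : I -> enat) (t : enat) :
  le_enat (enat_sup f) t <-> (forall i, le_enat (f i) t).
Proof.
case: t => [n|]; last by case: (enat_sup f) => // *; split=> // _ i; case: (f i).
by apply: le_least => p q lepq fp i; move: (fp i); case: (f i) => //= r /leq_trans; exact.
Qed.

Section DirectSum.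
Variables (R : pzRingType) (I : Type) (M : I -> lmodType R).

Record dsum := DSum {
  dsum_val :> forall i, M i;
  dsum_finsupp : finite_set [set i | dsum_val i != 0]%classic
}.

HB.instance Definition _ := gen_eqMixin dsum.
HB.instance Definition _ := gen_choiceMixin dsum.

Lemma dsum_ext (x y : dsum) : (forall i, x i = y i) -> x = y.
Proof.
case: x y => [f fP] [g gP] /= fg.
have {}fg : f = g by apply: functional_extensionality_dep.
by case: _ / fg in gP *; congr DSum; apply: Prop_irrelevance.
Qed.

Fact dsum0_finsupp : finite_set [set i | (0 : M i) != 0]%classic.
Proof. by rewrite (_ : mkset _ = set0) // -subset0 => i /=; rewrite eqxx. Qed.

Fact dsumN_finsupp (x : dsum) : finite_set [set i | - x i != 0]%classic.
Proof. by apply: sub_finite_set (dsum_finsupp x) => i /=; rewrite oppr_eq0. Qed.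

Fact dsumD_finsupp (x y : dsum) : finite_set [set i | x i + y i != 0]%classic.
Proof.
have fxy : finite_set ([set i | x i != 0] `|` [set i | y i != 0])%classic.
  by rewrite finite_setU; split; apply: dsum_finsupp.
apply: sub_finite_set fxy => i /= xy; have [x0|x0] := eqVneq (x i) 0; last by left.
by right; move: xy; rewrite x0 add0r.
Qed.

Fact dsumZ_finsupp (a : R) (x : dsum) :
  finite_set [set i | a *: x i != 0]%classic.
Proof.
apply: sub_finite_set (dsum_finsupp x) => i /=.
by apply: contra_neq => ->; rewrite scaler0.
Qed.

Definition dsum_zero := DSum dsum0_finsupp.
Definition dsum_opp x := DSum (dsumN_finsupp x).
Definition dsum_add x y := DSum (dsumD_finsupp x y).
Definition dsum_scale a x := DSum (dsumZ_finsupp a x).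

Fact dsum_addA : associative dsum_add.
Proof. by move=> x y z; apply: dsum_ext => i /=; rewrite addrA. Qed.
Fact dsum_addC : commutative dsum_add.
Proof. by move=> x y; apply: dsum_ext => i /=; rewrite addrC. Qed.
Fact dsum_add0 : left_id dsum_zero dsum_add.
Proof. by move=> x; apply: dsum_ext => i /=; rewrite add0r. Qed.
Fact dsum_addN : left_inverse dsum_zero dsum_opp dsum_add.
Proof. by move=> x; apply: dsum_ext => i /=; rewrite addNr. Qed.

HB.instance Definition _ :=
  GRing.isZmodule.Build dsum dsum_addA dsum_addC dsum_add0 dsum_addN.

Fact dsum_scaleA a b x : dsum_scale a (dsum_scale b x) = dsum_scale (a * b) x.
Proof. by apply: dsum_ext => i /=; rewrite scalerA. Qed.
Fact dsum_scale1 : left_id 1 dsum_scale.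
Proof. by move=> x; apply: dsum_ext => i /=; rewrite scale1r. Qed.
Fact dsum_scaleDr : right_distributive dsum_scale +%R.
Proof. by move=> a x y; apply: dsum_ext => i /=; rewrite scalerDr. Qed.
Fact dsum_scaleDl x : {morph dsum_scale^~ x : a b / a + b}.
Proof. by move=> a b; apply: dsum_ext => i /=; rewrite scalerDl. Qed.

HB.instance Definition _ := GRing.Zmodule_isLmodule.Build R dsum
  dsum_scaleA dsum_scale1 dsum_scaleDr dsum_scaleDl.

End DirectSum.

Definition direct_summand (R : pzRingType) (N M : lmodType R) : Prop :=
  exists (N' : lmodType R) (f : {linear (N * N')%type -> M}), bijective f.

(* Right R-modules are left modules over the converse ring R^c, so that m.r is
   written (r : R^c) *: m. *)

Section Tensor.
Variables (R : pzRingType) (M : lmodType R^c) (P : lmodType R).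

Local Notation free := {freeg (M * P)%type}.
Local Notation gen m p := (<< (m, p) >> : free).

(* The subgroup of the free abelian group on M * P spanned by the defining
   relations of the tensor product *)
Inductive tensor_rel : free -> Prop :=
| TensorDl m1 m2 p : tensor_rel (gen (m1 + m2) p - (gen m1 p + gen m2 p))
| TensorDr m p1 p2 : tensor_rel (gen m (p1 + p2) - (gen m p1 + gen m p2))
| TensorZ (r : R) m p : tensor_rel (gen ((r : R^c) *: m) p - gen m (r *: p))
| Tensor0 : tensor_rel 0
| TensorB x y : tensor_rel x -> tensor_rel y -> tensor_rel (x - y).

Definition tensor_relb : {pred free} := fun x => `[< tensor_rel x >].

Fact tensor_relb_zmod : zmod_closed tensor_relb.
Proof.
split=> [|x y]; first by apply/asboolP; exact: Tensor0.
by move=> /asboolP hx /asboolP hy; apply/asboolP; exact: TensorB.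
Qed.
HB.instance Definition _ :=
  GRing.isZmodClosed.Build free tensor_relb tensor_relb_zmod.

Definition tensor : zmodType := Quotient.quot tensor_relb.

Definition pure (m : M) (p : P) : tensor :=
  \pi_(Quotient.quot tensor_relb) (gen m p).

Lemma pi_tensor_eq0 (x : free) :
  \pi_(Quotient.quot tensor_relb) x = 0 :> tensor <-> tensor_rel x.
Proof.
rewrite -(raddf0 \pi_(Quotient.quot tensor_relb)).
rewrite (rwP eqP) -Quotient.idealrBE subr0.
by split=> [/asboolP|?] //; apply/asboolP.
Qed.

Lemma pureDl m1 m2 p : pure (m1 + m2) p = pure m1 p + pure m2 p.
Proof.
by apply/eqP; rewrite -subr_eq0 -!raddfD -raddfB; apply/eqP/pi_tensor_eq0/TensorDl.
Qed.

Lemma pureDr m p1 p2 : pure m (p1 + p2) = pure m p1 + pure m p2.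
Proof.
by apply/eqP; rewrite -subr_eq0 -!raddfD -raddfB; apply/eqP/pi_tensor_eq0/TensorDr.
Qed.

Lemma pureZ (r : R) m p : pure ((r : R^c) *: m) p = pure m (r *: p).
Proof.
by apply/eqP; rewrite -subr_eq0 -raddfB; apply/eqP/pi_tensor_eq0/TensorZ.
Qed.

Section Lift.
Variables (A : zmodType) (phi : M -> P -> A).

Definition free_lift (x : free) : A :=
  fglift (fun mp => phi mp.1 mp.2 : zmodule A) x.

Definition tensor_lift (t : tensor) : A := free_lift (repr t).

Fact free_lift_additive : zmod_morphism free_lift.
Proof.
by move=> x y; exact (lift_is_additive (fun mp => phi mp.1 mp.2 : zmodule A) x y).
Qed.
HB.instance Definition _ :=
  GRing.isZmodMorphism.Build free A free_lift free_lift_additive.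

Lemma free_liftU m p : free_lift (gen m p) = phi m p.
Proof. by rewrite /free_lift liftU scale1r. Qed.

Hypothesis phiDl : forall m1 m2 p, phi (m1 + m2) p = phi m1 p + phi m2 p.
Hypothesis phiDr : forall m p1 p2, phi m (p1 + p2) = phi m p1 + phi m p2.
Hypothesis phiZ : forall (r : R) m p, phi ((r : R^c) *: m) p = phi m (r *: p).

Lemma tensor_lift_pi x :
  tensor_lift (\pi_(Quotient.quot tensor_relb) x) = free_lift x.
Proof.
apply/eqP; rewrite -subr_eq0 -raddfB; apply/eqP.
suff: tensor_rel (repr (\pi_(Quotient.quot tensor_relb) x) - x).
  elim=> [m1 m2 p|m p1 p2|r m p||y z _ hy _ hz].
  - by rewrite raddfB raddfD /= !free_liftU phiDl subrr.
  - by rewrite raddfB raddfD /= !free_liftU phiDr subrr.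
  - by rewrite raddfB /= !free_liftU phiZ subrr.
  - exact: raddf0.
  - by rewrite raddfB /= hy hz subrr.
by apply/pi_tensor_eq0; rewrite raddfB /= reprK subrr.
Qed.

Lemma tensor_lift_pure m p : tensor_lift (pure m p) = phi m p.
Proof. by rewrite tensor_lift_pi free_liftU. Qed.

Lemma tensor_lift_additive : zmod_morphism tensor_lift.
Proof.
move=> s t; rewrite -[s]reprK -[t]reprK -raddfB !tensor_lift_pi; exact: raddfB.
Qed.

End Lift.

End Tensor.

Definition tensor_map (R : pzRingType) (M : lmodType R^c) (P Q : lmodType R)
    (g : {linear P -> Q}) : tensor M P -> tensor M Q :=
  tensor_lift (fun m p => pure m (g p)).

Section TensorMap.
Variables (R : pzRingType) (M : lmodType R^c) (P Q : lmodType R).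
Variable g : {linear P -> Q}.

Lemma tensor_map_pure m p : tensor_map g (pure m p) = pure m (g p) :> tensor M Q.
Proof.
apply: tensor_lift_pure => [m1 m2 q|n p1 p2|r n q]; first exact: pureDl.
- by rewrite linearD pureDr.
- by rewrite linearZ pureZ.
Qed.

Fact tensor_map_additive : zmod_morphism (tensor_map g : tensor M P -> tensor M Q).
Proof.
apply: tensor_lift_additive => [m1 m2 q|n p1 p2|r n q]; first exact: pureDl.
- by rewrite linearD pureDr.
- by rewrite linearZ pureZ.
Qed.
HB.instance Definition _ := GRing.isZmodMorphism.Build _ _
  (tensor_map g : tensor M P -> tensor M Q) tensor_map_additive.

End TensorMap.

Definition exact_at (A B C : zmodType) (f : A -> B) (g : B -> C) : Prop :=
  forall b, g b = 0 <-> exists a, f a = b.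

(* Homological indexing: C (n + 1) -> C n. As n ranges over all of int, this
   says that every degree is exact; it includes d \o d = 0. *)
Definition acyclic (C : int -> zmodType) (d : forall n, C (n + 1) -> C n) : Prop :=
  forall n, exact_at (d (n + 1)) (d n).

Definition is_kernel (A B C : zmodType) (f : A -> B) (g : B -> C) : Prop :=
  injective f /\ exact_at f g.

Definition injective_module (S : pzRingType) (E : lmodType S) : Prop :=
  forall (A B : lmodType S) (g : {linear A -> B}) (f : {linear A -> E}),
    injective g ->
  exists h : {linear B -> E}, forall a, h (g a) = f a.

Section PGF.
Variable R : pzRingType.

Definition projective (P : lmodType R) : Prop :=
  forall (A B : lmodType R) (g : {linear A -> B}) (f : {linear P -> B}),
    (forall b, exists a, g a = b) ->
  exists h : {linear P -> A}, forall p, g (h p) = f p.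

Definition PGF (M : lmodType R) : Prop :=
  exists (P : int -> lmodType R) (d : forall n, {linear P (n + 1) -> P n}),
  [/\ forall n, projective (P n),
      acyclic d,
      forall I : lmodType R^c, injective_module I ->
        acyclic (fun n => tensor_map (d n) : tensor I _ -> tensor I _) &
      exists (n : int) (f : {linear M -> P (n + 1)}), is_kernel f (d n)].

(* An exact sequence 0 -> G_n -> ... -> G_0 -> M -> 0, extended by G_k = 0 for
   k > n *)
Definition PGF_resolution (M : lmodType R) (n : nat) : Prop :=
  exists (G : nat -> lmodType R) (d : forall k, {linear G k.+1 -> G k})
         (e : {linear G 0%N -> M}),
  [/\ forall k, (k <= n)%N -> PGF (G k),
      forall k, (n < k)%N -> forall x : G k, x = 0,
      forall m, exists x, e x = m,
      exact_at (d 0%N) e &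
      forall k, exact_at (d k.+1) (d k)].

Definition PGF_dim (M : lmodType R) : enat := least (PGF_resolution M).

Definition finite_PGF_dim (M : lmodType R) : Prop := PGF_dim M <> Infty.

End PGF.

(* Main.v *)
(* View a complex of projectives P such that I (x) P is acyclic for all injective I
   as one differential module (P, d).  For a finite subset T of P, embed the right
   module R^T / {(psi (d t))_t | psi in Hom(P, R)} into an injective I.  The images
   of the basis vectors yield a cycle of I (x) P, hence a boundary, supported on a
   finite set S: every phi with phi \o d = 0 on S agrees on T with some psi \o d.
   Zorn's lemma and a Mittag-Leffler argument over countable sets make this local
   solvability global, so Hom(P, F) is acyclic for F projective, and
   Ext^1(M, F) = 0 for M in PGF.

   PGF is the largest class of modules X with Tor_1(I, X) = 0 for I injective in
   which every X is both the kernel and the cokernel of a short exact sequence with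
   projective middle term and third term in the class.  Closure under sums, extensions
   and direct summands follows coinductively, the last two by Ext^1(PGF, F) = 0.
   Hence PGF-dim M <= n iff some n-th syzygy of M is PGF, a property that passes to
   sums and summands. *)
From HB Require Import structures.
From mathcomp Require Import all_boot all_order all_algebra.
From mathcomp Require Import boolp classical_sets cardinality.
From mathcomp Require Import freeg.
Require Import Defs.

Set Implicit Arguments.
Unset Strict Implicit.
Unset Printing Implicit Defensive.

Import GRing.Theory.

Local Open Scope ring_scope.
Local Open Scope quotient_scope.

(** * Modules *)

(** The obstacle is the vanishing of Ext^1 with projective coefficients. The definition of PGF gives
    exactness only after tensoring, whereas continuing an extension or a summand to the right
    requires extending maps into projective modules. An element of a tensor product involves
    finitely many elements of P, so tensoring yields solvability on finite sets only. Along an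
    increasing sequence of finite sets, successive solutions can be corrected so as to agree on what
    precedes; this is specific to sequences, so each Zorn step adds a countable set and works modulo
    the part already solved. Solutions are glued as mere functions and made linear by a dual basis
    of P. Forming one differential module preserves projectivity, since a direct sum of projectives
    is projective, and turns all degrees into a single equation. Having an n-th syzygy in PGF is an
    existential condition: each closure argument builds the presentation that suits it, in place of
    a comparison between presentations. *)

Definition mklinear (R : pzRingType) (A B : lmodType R) (f : A -> B)
    (fL : linear f) : {linear A -> B} :=
  HB.pack f (GRing.isLinear.Build R A B *:%R f fL).

Definition mkadditive (A B : zmodType) (f : A -> B)
    (fB : zmod_morphism f) : {additive A -> B} :=
  HB.pack f (GRing.isZmodMorphism.Build A B f fB).

Lemma quotient_zmod (V : zmodType) (W : V -> Prop) :
  W 0 -> (forall x y, W x -> W y -> W (x - y)) ->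
  exists (C : zmodType) (p : {additive V -> C}),
    (forall c, exists v, p v = c) /\ (forall v, p v = 0 <-> W v).
Proof.
move=> W0 WB; pose w : {pred V} := fun x => `[< W x >].
have wP : zmod_closed w.
  split=> [|x y]; first exact/asboolP.
  by move=> /asboolP hx /asboolP hy; apply/asboolP/WB.
pose w' : zmodClosed V := HB.pack w (GRing.isZmodClosed.Build V w wP).
have piB : zmod_morphism (\pi_(Quotient.quot w') : V -> Quotient.quot w').
  exact: raddfB.
exists (Quotient.quot w'), (mkadditive piB); split=> [c|v /=].
  by exists (repr c); exact: reprK.
rewrite -[X in _ = X](raddf0 \pi_(Quotient.quot w')) (rwP eqP).
by rewrite -Quotient.idealrBE subr0; split=> [/asboolP|?] //; apply/asboolP.
Qed.

(** Laws as data: the scaling of a quotient only exists inside a proof, where [lmod_of] turns it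
    into an [lmodType]. *)
Record lmod_law (R : pzRingType) (C : zmodType) := LmodLaw {
  law_scale :> R -> C -> C;
  law_scaleA : forall a b v, law_scale a (law_scale b v) = law_scale (a * b) v;
  law_scale1 : left_id 1 law_scale;
  law_scaleDr : right_distributive law_scale +%R;
  law_scaleDl : forall v, {morph law_scale^~ v : a b / a + b}
}.

Section LmodOf.
Variables (R : pzRingType) (C : zmodType) (sc : lmod_law R C).

Definition lmod_of (_ : lmod_law R C) : Type := C.

HB.instance Definition _ := GRing.Zmodule.on (lmod_of sc).
HB.instance Definition _ := GRing.Zmodule_isLmodule.Build R (lmod_of sc)
  (law_scaleA sc) (law_scale1 sc) (law_scaleDr sc) (law_scaleDl sc).

End LmodOf.

Section SubLmod.
Variables (R : pzRingType) (V : lmodType R) (w : submodClosed V).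

Definition sub_lmod : Type := {x : V | x \in w}.
HB.instance Definition _ := SubType.on sub_lmod.
HB.instance Definition _ := Choice.on sub_lmod.
HB.instance Definition _ := [SubChoice_isSubLmodule of sub_lmod by <:].


End SubLmod.

Section Modules.
Variable R : pzRingType.
Implicit Types A B C D : lmodType R.

(** Scalars act through a set-theoretic section of [p]. By [pZ] the action does not depend on it, so
    each law is checked on images of [p]. *)
Lemma quotient_lmod (V : lmodType R) (W : V -> Prop) :
  W 0 -> (forall a x y, W x -> W y -> W (a *: x + y)) ->
  exists (C : lmodType R) (p : {linear V -> C}),
    (forall c, exists v, p v = c) /\ (forall v, p v = 0 <-> W v).
Proof.
move=> W0 WL.
have WB x y : W x -> W y -> W (x - y).
  by move=> Wx Wy; rewrite addrC -scaleN1r; apply: WL.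
have [C [p [psurj pker]]] := quotient_zmod W0 WB.
have [s sK] := choice psurj.
pose sc (a : R) (c : C) : C := p (a *: s c).
have pZ a v : p (a *: v) = sc a (p v).
  apply/eqP; rewrite -subr_eq0 -raddfB; apply/eqP/pker.
  rewrite -scalerBr -[_ *: _]addr0; apply: (WL) => //.
  by apply/pker; rewrite raddfB sK subrr.
have scA a b v : sc a (sc b v) = sc (a * b) v.
  by rewrite -[v]sK -!pZ scalerA.
have sc1 : left_id 1 sc by move=> v; rewrite -[v]sK -pZ scale1r.
have scDr : right_distributive sc +%R.
  by move=> a u v; rewrite -[u]sK -[v]sK -raddfD -!pZ scalerDr raddfD.
have scDl v : {morph sc^~ v : a b / a + b}.
  by move=> a b; rewrite -[v]sK -!pZ scalerDl raddfD.
pose Cl : lmodType R := lmod_of (LmodLaw scA sc1 scDr scDl).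
have pL : linear (p : V -> Cl) by move=> a u v; rewrite raddfD pZ.
by exists Cl, (mklinear pL).
Qed.

Lemma submodule_lmod (V : lmodType R) (W : V -> Prop) :
  W 0 -> (forall a x y, W x -> W y -> W (a *: x + y)) ->
  exists (C : lmodType R) (i : {linear C -> V}),
    injective i /\ (forall v, W v <-> exists c, i c = v).
Proof.
move=> W0 WL; pose w : {pred V} := fun x => `[< W x >].
have wP : submod_closed w.
  split=> [|a x y]; first exact/asboolP.
  by move=> /asboolP hx /asboolP hy; apply/asboolP/WL.
pose w' : submodClosed V := HB.pack w (GRing.isSubmodClosed.Build R V w wP).
pose Tm : lmodType R := sub_lmod w'.
have iL : linear (val : Tm -> V) by move=> a u v.
exists Tm, (mklinear iL); split=> [|v]; first exact: val_inj.
split=> [Wv|[c <-]]; last exact/asboolP/(valP c).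
have wv : v \in w' by apply/asboolP.
by exists (exist _ v wv).
Qed.

End Modules.

(** * Short exact sequences and factorisation of linear maps *)

Section Sequences.
Variable R : pzRingType.
Implicit Types A B C D : lmodType R.

Definition surj A B (p : A -> B) := forall b, exists a, p a = b.

Definition ses A B C (i : {linear A -> B}) (p : {linear B -> C}) :=
  [/\ injective i, exact_at i p & surj p].

Lemma linear_inj A B (f : {linear A -> B}) :
  (forall a, f a = 0 -> a = 0) -> injective f.
Proof.
move=> f0 x y fxy; apply/eqP; rewrite -subr_eq0; apply/eqP/f0.
by rewrite linearB fxy subrr.
Qed.

Lemma ses_comp A B C (i : {linear A -> B}) (p : {linear B -> C}) a :
  ses i p -> p (i a) = 0.
Proof. by case=> _ ex _; apply/ex; exists a. Qed.

Lemma kernel_lmod A B (f : {linear A -> B}) :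
  exists (K : lmodType R) (i : {linear K -> A}), injective i /\ exact_at i f.
Proof.
have [|a x y|K [i [ii iE]]] := @submodule_lmod R A (fun x => f x = 0).
- exact: linear0.
- by move=> fx fy; rewrite linearP fx fy scaler0 addr0.
- by exists K, i.
Qed.

Lemma ses_kernel A B (p : {linear A -> B}) :
  surj p -> exists (K : lmodType R) (i : {linear K -> A}), ses i p.
Proof. by move=> sp; have [K [i [? ?]]] := kernel_lmod p; exists K, i. Qed.

Lemma ses_cokernel A B (i : {linear A -> B}) :
  injective i -> exists (C : lmodType R) (p : {linear B -> C}), ses i p.
Proof.
move=> ii.
have [|a _ _ [x <-] [y <-]|C [p [sp pE]]] :=
  @quotient_lmod R B (fun b => exists a, i a = b).
- by exists 0; rewrite linear0.
- by exists (a *: x + y); rewrite linearP.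
- by exists C, p; split.
Qed.

Lemma factor_surj A B C (p : {linear A -> B}) (f : {linear A -> C}) :
  surj p -> (forall a, p a = 0 -> f a = 0) ->
  exists h : {linear B -> C}, forall a, h (p a) = f a.
Proof.
move=> sp pf; have [s sK] := choice sp.
have hp a : f (s (p a)) = f a.
  by apply/eqP; rewrite -subr_eq0 -linearB; apply/eqP/pf; rewrite linearB sK subrr.
have hL : linear (f \o s).
  by move=> a x y /=; rewrite -[x]sK -[y]sK -linearP !hp linearP.
by exists (mklinear hL).
Qed.

Lemma factor_inj A B C (i : {linear A -> B}) (f : {linear C -> B}) :
  injective i -> (forall c, exists a, i a = f c) ->
  exists h : {linear C -> A}, forall c, i (h c) = f c.
Proof.
move=> ii fi; have [h hE] := choice fi.
have hL : linear h by move=> a x y; apply: ii; rewrite linearP !hE linearP.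
by exists (mklinear hL).
Qed.

Definition retract_of A B := exists (s : {linear A -> B}) (r : {linear B -> A}),
  forall a, r (s a) = a.

Lemma projective_prod A B : projective A -> projective B ->
  projective (A * B)%type.
Proof.
move=> pA pB X Y g f sg.
have iAL : linear (fun a : A => (a, 0 : B)).
  by move=> a x y; apply: injective_projections; rewrite /= ?scaler0 ?addr0.
have iBL : linear (fun b : B => (0 : A, b)).
  by move=> a x y; apply: injective_projections; rewrite /= ?scaler0 ?addr0.
have [hA hAE] := pA X Y g (f \o mklinear iAL) sg.
have [hB hBE] := pB X Y g (f \o mklinear iBL) sg.
have hL : linear (fun z : A * B => hA z.1 + hB z.2).
  by move=> a x y; rewrite !linearP /= scalerDr addrACA.
exists (mklinear hL) => -[a b] /=.
rewrite linearD hAE hBE /= -linearD; congr (f _).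
by apply: injective_projections; rewrite /= ?addr0 ?add0r.
Qed.

End Sequences.

(** * Direct sums: injections, projections, universal property *)

Section DsumTheory.
Variables (R : pzRingType) (I : choiceType).
Implicit Types M N : I -> lmodType R.

Definition dsum_proj M i : dsum M -> M i := fun x => x i.
Fact dsum_proj_linear M i : linear (@dsum_proj M i). Proof. by []. Qed.
HB.instance Definition _ M i :=
  GRing.isLinear.Build R (dsum M) (M i) *:%R (@dsum_proj M i)
    (@dsum_proj_linear M i).

(** In a dependent family [x] has to be transported along [i = j]; decidable equality on [I] makes
    the transport along [i = i] the identity. *)
Definition dsum_in_fun M i (x : M i) j : M j :=
  if @eqP _ i j is ReflectT e then eq_rect i (fun k => M k) x j e else 0.

Lemma dsum_in_fun_same M i (x : M i) : dsum_in_fun x i = x.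
Proof. by rewrite /dsum_in_fun; case: eqP => // e; rewrite eq_axiomK. Qed.

Lemma dsum_in_fun_neq M i j (x : M i) : i <> j -> dsum_in_fun x j = 0.
Proof. by rewrite /dsum_in_fun; case: eqP. Qed.

Fact dsum_in_finsupp M i (x : M i) :
  finite_set [set j | dsum_in_fun x j != 0]%classic.
Proof.
apply: (@sub_finite_set _ _ [set i]%classic) => [j /=|]; last exact: finite_set1.
by apply: contra_neqP => ij; rewrite dsum_in_fun_neq // => ?; apply: ij.
Qed.

Definition dsum_in M i (x : M i) : dsum M := DSum (dsum_in_finsupp x).

Lemma dsum_in_same M i (x : M i) : dsum_in x i = x.
Proof. exact: dsum_in_fun_same. Qed.

Lemma dsum_in_neq M i j (x : M i) : i <> j -> dsum_in x j = 0.
Proof. exact: dsum_in_fun_neq. Qed.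

Fact dsum_in_linear M i : linear (@dsum_in M i).
Proof.
move=> a x y; apply: dsum_ext => j /=.
have [<-|ij] := pselect (i = j); first by rewrite !dsum_in_fun_same.
by rewrite !dsum_in_fun_neq // scaler0 addr0.
Qed.
HB.instance Definition _ M i :=
  GRing.isLinear.Build R (M i) (dsum M) *:%R (@dsum_in M i)
    (@dsum_in_linear M i).

(** The list is only known to contain the support. *)
Lemma dsum_suppP M (x : dsum M) :
  {s : seq I | uniq s & forall i, i \notin s -> x i = 0}.
Proof.
have /cid[s sE] : exists s : seq I, forall i, i \notin s -> x i = 0.
  have /finite_seqP[s sE] := dsum_finsupp x; exists s => i.
  apply: contraNeq => xi; have : [set` s]%classic i by rewrite -sE.
  by [].
exists (undup s); first exact: undup_uniq.
by move=> i; rewrite mem_undup; exact: sE.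
Qed.

Definition dsum_supp M (x : dsum M) : seq I := sval (dsum_suppP x).

Lemma dsum_supp_uniq M (x : dsum M) : uniq (dsum_supp x).
Proof. by rewrite /dsum_supp; case: dsum_suppP. Qed.

Lemma dsum_suppN M (x : dsum M) i : i \notin dsum_supp x -> x i = 0.
Proof. by rewrite /dsum_supp; case: dsum_suppP => s /= _; apply. Qed.

Section Out.
Variables (M : I -> lmodType R) (A : lmodType R) (f : forall i, {linear M i -> A}).

Definition dsum_out (x : dsum M) : A := \sum_(i <- dsum_supp x) f i (x i).

Lemma dsum_outE (x : dsum M) (s : seq I) : uniq s ->
  (forall i, i \notin s -> x i = 0) -> dsum_out x = \sum_(i <- s) f i (x i).
Proof.
move=> us sx; rewrite /dsum_out.
have aux (s1 s2 : seq I) : uniq s1 -> uniq s2 -> {subset s1 <= s2} ->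
    (forall i, i \notin s1 -> x i = 0) ->
    \sum_(i <- s1) f i (x i) = \sum_(i <- s2) f i (x i).
  move=> u1 u2 s12 x0; rewrite [RHS](bigID (mem s1)) /= [X in _ = _ + X]big1 ?addr0.
    rewrite -[RHS]big_filter; apply: perm_big; apply: uniq_perm => //.
      exact: filter_uniq.
    by move=> i; rewrite mem_filter /=; case: (boolP (i \in s1)) => // /s12 ->.
  by move=> i /x0 ->; rewrite linear0.
(* Two lists containing the support are compared through their union. *)
pose t := undup (s ++ dsum_supp x).
rewrite (aux _ t) ?undup_uniq ?dsum_supp_uniq //; first last.
- by move=> i; apply: dsum_suppN.
- by move=> i; rewrite mem_undup mem_cat orbC => ->.
rewrite (aux s t) ?undup_uniq // => i.
by rewrite mem_undup mem_cat => ->.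
Qed.

Fact dsum_out_linear : linear dsum_out.
Proof.
move=> a x y.
pose s := undup (dsum_supp x ++ dsum_supp y).
have xs i : i \notin s -> x i = 0.
  by rewrite mem_undup mem_cat negb_or => /andP[/dsum_suppN].
have ys i : i \notin s -> y i = 0.
  by rewrite mem_undup mem_cat negb_or => /andP[_ /dsum_suppN].
rewrite !(@dsum_outE _ s) ?undup_uniq //; last first.
  by move=> i si /=; rewrite xs // ys // scaler0 addr0.
by rewrite scaler_sumr -big_split; apply: eq_bigr => i _ /=; rewrite linearP.
Qed.
HB.instance Definition _ :=
  GRing.isLinear.Build R (dsum M) A *:%R dsum_out dsum_out_linear.

Lemma dsum_out_in i (x : M i) : dsum_out (dsum_in x) = f i x.
Proof.
rewrite (@dsum_outE _ [:: i]) // => [|j].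
  by rewrite big_seq1 dsum_in_same.
by rewrite inE => /eqP ji; rewrite dsum_in_neq // => ij; apply: ji.
Qed.

End Out.

Lemma dsum_sum M (x : dsum M) (s : seq I) : uniq s ->
  (forall i, i \notin s -> x i = 0) ->
  x = \sum_(i <- s) dsum_in (x i).
Proof.
move=> us sx; apply: dsum_ext => j.
rewrite -[RHS]/(@dsum_proj M j _) linear_sum /=.
have [js|js] := boolP (j \in s); last first.
  rewrite sx // big_seq big1 // => i si.
  rewrite -[LHS]/(dsum_in (x i) j) dsum_in_neq // => ij.
  by rewrite -ij si in js.
rewrite (bigD1_seq j) //= big1 ?addr0 => [|i /eqP ij].
  by rewrite -[RHS]/(dsum_in (x j) j) dsum_in_same.
by rewrite -[LHS]/(dsum_in (x i) j) dsum_in_neq.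
Qed.

Lemma dsum_map_finsupp M N (g : forall i, {linear M i -> N i}) (x : dsum M) :
  finite_set [set i | g i (x i) != 0]%classic.
Proof.
apply: sub_finite_set (dsum_finsupp x) => i /=.
by apply: contra_neq => ->; rewrite linear0.
Qed.

Definition dsum_map M N (g : forall i, {linear M i -> N i}) (x : dsum M) :
  dsum N := DSum (dsum_map_finsupp g x).

Fact dsum_map_linear M N (g : forall i, {linear M i -> N i}) :
  linear (dsum_map g).
Proof. by move=> a x y; apply: dsum_ext => i /=; rewrite linearP. Qed.
HB.instance Definition _ M N (g : forall i, {linear M i -> N i}) :=
  GRing.isLinear.Build R (dsum M) (dsum N) *:%R (dsum_map g) (dsum_map_linear g).

Lemma dsum_build M (f : forall i, M i) (s : seq I) :
  (forall i, i \notin s -> f i = 0) -> exists x : dsum M, forall i, x i = f i.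
Proof.
move=> sf; have fin : finite_set [set i | f i != 0]%classic.
  apply: (@sub_finite_set _ _ [set` s]%classic) => [i /=|].
    by apply: contraNT => /sf ->; rewrite eqxx.
  by apply/finite_seqP; exists s.
by exists (DSum fin).
Qed.

(** Outside [s] the choice has to be 0 for the family to have finite support. *)
Lemma dsum_choice M (P : forall i, M i -> Prop) (s : seq I) :
  (forall i, exists m, P i m) -> (forall i, i \notin s -> P i 0) ->
  exists x : dsum M, forall i, P i (x i).
Proof.
move=> exP P0.
have exP' i : exists m, P i m /\ (i \notin s -> m = 0).
  have [si|si] := boolP (i \in s); first by have [m] := exP i; exists m.
  by exists 0; split=> //; apply: P0.
pose f i := sval (cid (exP' i)).
have [i si|x xE] := @dsum_build M f s.
  by rewrite /f; case: cid => m /= [_]; apply.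
by exists x => i; rewrite xE /f; case: cid => m /= [].
Qed.

Lemma dsum_projective M : (forall i, projective (M i)) -> projective (dsum M).
Proof.
move=> pM A B g f sg.
have hP i := pM i A B g (f \o @dsum_in M i) sg.
pose h i := sval (cid (hP i)).
have hE i m : g (h i m) = f (dsum_in m) by rewrite /h; case: cid.
exists (dsum_out h) => x.
rewrite [X in g X](dsum_outE h (dsum_supp_uniq x) (@dsum_suppN _ x)) linear_sum.
rewrite [in RHS](dsum_sum (dsum_supp_uniq x) (@dsum_suppN _ x)) linear_sum.
by apply: eq_bigr => i _; rewrite hE.
Qed.

Lemma dsum_ses M N (L : I -> lmodType R) (g : forall i, {linear M i -> N i})
    (h : forall i, {linear N i -> L i}) :
  (forall i, ses (g i) (h i)) -> ses (dsum_map g) (dsum_map h).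
Proof.
move=> gh; split=> [|y|z].
- apply: linear_inj => x gx0; apply: dsum_ext => i /=.
  have [gi _ _] := gh i; apply: gi; rewrite linear0.
  by rewrite -[LHS]/(dsum_map g x i) gx0.
- split=> [hy|[x <-]]; last first.
    by apply: dsum_ext => i /=; have := ses_comp (x i) (gh i).
  have [||x xE] := @dsum_choice M (fun i m => g i m = y i) (dsum_supp y).
  + move=> i; have [_ ex _] := gh i; apply/ex.
    by rewrite -[LHS]/(dsum_map h y i) hy.
  + by move=> i /dsum_suppN ->; rewrite linear0.
  + by exists x; apply: dsum_ext.
- have [||x xE] := @dsum_choice N (fun i m => h i m = z i) (dsum_supp z).
  + by move=> i; have [_ _] := gh i; apply.
  + by move=> i /dsum_suppN ->; rewrite linear0.
  + by exists x; apply: dsum_ext.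
Qed.

Lemma dsum_in_retract M i : retract_of (M i) (dsum M).
Proof.
exists (@dsum_in M i), (@dsum_proj M i) => m; exact: dsum_in_same.
Qed.

End DsumTheory.

(** * Free modules, and projectives as their retracts *)

Section Free.
Variable R : pzRingType.
Implicit Types P : lmodType R.

Definition free_lmod (B : choiceType) : lmodType R := dsum (fun _ : B => R^o).

Lemma scale_elt_linear P (p : P) : linear (fun r : R^o => (r : R) *: p).
Proof. by move=> b x y; rewrite scalerDl scalerA. Qed.

Lemma free_surj P : exists p : {linear free_lmod P -> P}, surj p.
Proof.
pose f (b : P) : {linear R^o -> P} := mklinear (scale_elt_linear b).
exists (dsum_out f) => b; exists (@dsum_in _ _ (fun _ => R^o) b 1).
by rewrite [LHS](dsum_out_in f) /= scale1r.
Qed.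

Lemma projective_free P : projective P -> retract_of P (free_lmod P).
Proof.
move=> pP; have [p sp] := free_surj P.
have [s sE] := pP _ _ p idfun sp.
by exists s, p.
Qed.

End Free.

(** * Tensor products *)

Section TensorTheory.
Variables (R : pzRingType) (M : lmodType R^c).
Implicit Types P Q A B C : lmodType R.

Lemma pure0r P (m : M) : pure m (0 : P) = 0.
Proof. by apply/(addIr (pure m (0 : P))); rewrite -pureDr !add0r. Qed.

Lemma pure0l P (p : P) : pure (0 : M) p = 0.
Proof. by apply/(addIr (pure (0 : M) p)); rewrite -pureDl !add0r. Qed.

Lemma pureNl P (m : M) (p : P) : pure (- m) p = - pure m p.
Proof. by apply/(addIr (pure m p)); rewrite -pureDl !addNr pure0l. Qed.

Lemma pureNr P (m : M) (p : P) : pure m (- p) = - pure m p.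
Proof. by apply/(addIr (pure m p)); rewrite -pureDr !addNr pure0r. Qed.

(** Integer coefficients in the free abelian group become repetitions, and signs are absorbed by the
    first factor. *)
Lemma tensor_sum P (z : tensor M P) :
  exists s : seq (M * P), z = \sum_(x <- s) pure x.1 x.2.
Proof.
pose K (z : tensor M P) := exists s : seq (M * P), z = \sum_(x <- s) pure x.1 x.2.
have K0 : K 0 by exists [::]; rewrite big_nil.
have KD x y : K x -> K y -> K (x + y).
  by move=> [s ->] [t ->]; exists (s ++ t); rewrite big_cat.
have KN x : K x -> K (- x).
  move=> [s ->]; exists [seq (- y.1, y.2) | y <- s].
  by rewrite big_map -sumrN; apply: eq_bigr => y _; rewrite pureNl.
have Kn x n : K x -> K (x *+ n).
  by move=> Kx; elim: n => [|n IH]; rewrite ?mulr0n // mulrS; apply: KD.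
rewrite -/(K z) -[z]reprK -[repr z]freeg_sumE raddf_sum.
apply: big_ind => // -[m p] _.
rewrite -[coeff _ _]intz -freegU_mulz raddfMz /=.
have Kmp : K (pure m p) by exists [:: (m, p)]; rewrite big_seq1.
by case: (coeff _ _) => n; [apply: Kn|apply: KN; apply: Kn].
Qed.

Lemma tensor_map_comp P Q A (f : {linear P -> Q}) (g : {linear Q -> A})
    (h : {linear P -> A}) :
  (forall p, g (f p) = h p) ->
  forall z : tensor M P, tensor_map g (tensor_map f z) = tensor_map h z.
Proof.
move=> gf z; have [s ->] := tensor_sum z.
by rewrite !raddf_sum; apply: eq_bigr => x _; rewrite /= !tensor_map_pure gf.
Qed.

Lemma tensor_map_id P (f : {linear P -> P}) :
  (forall p, f p = p) -> forall z : tensor M P, tensor_map f z = z.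
Proof.
move=> fE z; have [s ->] := tensor_sum z.
by rewrite !raddf_sum; apply: eq_bigr => x _; rewrite /= tensor_map_pure fE.
Qed.

Lemma tensor_map0 P Q (f : {linear P -> Q}) :
  (forall p, f p = 0) -> forall z : tensor M P, tensor_map f z = 0.
Proof.
move=> fE z; have [s ->] := tensor_sum z.
by rewrite !raddf_sum big1 // => x _; rewrite /= tensor_map_pure fE pure0r.
Qed.

Lemma tensor_map_inj P Q (f : {linear P -> Q}) :
  (forall z : tensor M P, tensor_map f z = 0 -> z = 0) ->
  injective (tensor_map f : tensor M P -> tensor M Q).
Proof.
move=> f0 x y fxy; apply/eqP; rewrite -subr_eq0; apply/eqP/f0.
by rewrite raddfB /= fxy subrr.
Qed.

Lemma tensor_map_surj P Q (f : {linear P -> Q}) :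
  surj f -> forall z : tensor M Q, exists w, tensor_map f w = z.
Proof.
move=> sf z; have [s ->] := tensor_sum z.
elim: s => [|x s [w wE]]; first by exists 0; rewrite raddf0 big_nil.
have [p pE] := sf x.2; exists (pure x.1 p + w).
by rewrite raddfD /= wE big_cons /= tensor_map_pure pE.
Qed.

(** Let [q] be the cokernel of [tensor_map i]. Modulo its image, [pure m b] depends only on [p b],
    so [q] factors through [tensor_map p] by a map [L]; what [tensor_map p] kills, [q] kills too. *)
Lemma tensor_right_exact A B C (i : {linear A -> B}) (p : {linear B -> C}) :
  exact_at i p -> surj p ->
  forall z : tensor M B, tensor_map p z = 0 -> exists w, tensor_map i w = z.
Proof.
move=> ex sp z pz.
have [|_ _ [x <-] [y <-]|D [q [sq qE]]] :=
  @quotient_zmod (tensor M B) (fun b => exists a, tensor_map i a = b).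
- by exists 0; rewrite raddf0.
- by exists (x - y); rewrite raddfB.
apply/qE; have [s sK] := choice sp.
pose phi m c := q (pure m (s c)).
have phip m b : phi m (p b) = q (pure m b).
  apply/eqP; rewrite -subr_eq0 -raddfB -pureNr -pureDr; apply/eqP/qE.
  have /ex[a aE] : p (s (p b) - b) = 0 by rewrite linearB sK subrr.
  by exists (pure m a); rewrite tensor_map_pure aE.
have phiDl m1 m2 c : phi (m1 + m2) c = phi m1 c + phi m2 c.
  by rewrite /phi pureDl raddfD.
have phiDr m c1 c2 : phi m (c1 + c2) = phi m c1 + phi m c2.
  by rewrite -[c1]sK -[c2]sK -linearD !phip pureDr raddfD.
have phiZ (r : R) m c : phi ((r : R^c) *: m) c = phi m (r *: c).
  by rewrite -[c]sK -linearZ !phip pureZ.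
pose L := mkadditive (tensor_lift_additive phiDl phiDr phiZ).
have -> : q z = L (tensor_map p z); last by rewrite pz raddf0.
have [t ->] := tensor_sum z.
rewrite !raddf_sum; apply: eq_bigr => x _ /=.
by rewrite tensor_map_pure tensor_lift_pure // phip.
Qed.

Lemma tensor_dsum_sum (I : choiceType) (X : I -> lmodType R)
    (z : tensor M (dsum X)) :
  exists s : seq I, z = \sum_(i <- s)
    tensor_map (@dsum_in R I X i) (tensor_map (@dsum_proj R I X i) z).
Proof.
have [t ->] := tensor_sum z.
pose s := undup (flatten [seq dsum_supp x.2 | x <- t]); exists s.
under [RHS]eq_bigr do rewrite !raddf_sum.
rewrite exchange_big /= !big_seq; apply: eq_bigr => x xt.
under eq_bigr do rewrite /= !tensor_map_pure.
have := @dsum_sum _ _ _ x.2 s (undup_uniq _) => /(_ _)/wrap[i|{1}->].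
  rewrite mem_undup => si; apply: dsum_suppN; apply: contra si => xi.
  by apply/flattenP; exists (dsum_supp x.2) => //; apply: map_f.
by elim/big_rec2 : _ => [|i y1 y2 _ <-]; rewrite ?pure0r // pureDr.
Qed.

(** An element of the tensor product involves finitely many summands and is rebuilt from its
    components there. *)
Lemma tensor_dsum_eq0 (I : choiceType) (X : I -> lmodType R)
    (z : tensor M (dsum X)) :
  (forall i, tensor_map (@dsum_proj R I X i) z = 0) -> z = 0.
Proof.
move=> z0; have [s ->] := tensor_dsum_sum z.
by rewrite big1 // => i _; rewrite z0 raddf0.
Qed.

(** Functionals separate the elements: [P] embeds in a free module as a retract, and the coordinates
    there are functionals on [P]. *)
Lemma tensor_projective_eq0 P (z : tensor M P) : projective P ->
  (forall psi : {linear P -> R^o}, tensor_map psi z = 0) -> z = 0.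
Proof.
move=> /projective_free[s [r rs]] z0.
have E : tensor_map s z = 0.
  apply: tensor_dsum_eq0 => b.
  by rewrite (@tensor_map_comp _ _ _ s _ (@dsum_proj R P (fun _ => R^o) b \o s)).
rewrite -[z](@tensor_map_id _ (r \o s) rs).
by rewrite -(@tensor_map_comp _ _ _ s r) // E raddf0.
Qed.

(** This is [tensor_map phi] followed by the identification of M (x) R with M. *)
Lemma tensor_eval P (phi : {linear P -> R^o}) :
  exists ev : {additive tensor M P -> M},
    forall m p, ev (pure m p) = ((phi p : R) : R^c) *: m.
Proof.
pose f (m : M) (p : P) : M := ((phi p : R) : R^c) *: m.
have fDl m1 m2 p : f (m1 + m2) p = f m1 p + f m2 p by rewrite /f scalerDr.
have fDr m p1 p2 : f m (p1 + p2) = f m p1 + f m p2.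
  by rewrite /f linearD -scalerDl.
have fZ (r : R) m p : f ((r : R^c) *: m) p = f m (r *: p).
  by rewrite /f linearZ /= scalerA.
exists (mkadditive (tensor_lift_additive fDl fDr fZ)) => m p /=.
exact: tensor_lift_pure.
Qed.

End TensorTheory.

(** * Enough injective modules *)

Definition divisible (D : zmodType) :=
  forall (n : nat) (d : D), (0 < n)%N -> exists d', d' *+ n = d.

(** * Homomorphisms into divisible groups *)

Section DivisibleExtension.
Variables (A B D : zmodType) (g : {additive A -> B}) (f : {additive A -> D}).
Hypotheses (divD : divisible D) (ginj : injective g).

(** The graph of a homomorphism on a subgroup of [B] that contains the image of [g], given there by
    [f]; the last clause makes the graph single-valued. *)
Definition partial_hom (G : set (B * D)) :=
  [/\ forall a, G (g a, f a),
      forall x y, G x -> G y -> G (x - y) &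
      forall d, G (0, d) -> d = 0].

Let PG (G : set (B * D)) := (exists x, G x) -> partial_hom G.

Lemma partial_hom0 G : partial_hom G -> G 0.
Proof. by case=> G0 _ _; have := G0 0; rewrite !raddf0. Qed.

Lemma partial_homN G x : partial_hom G -> G x -> G (- x).
Proof.
move=> PHG Gx; rewrite -sub0r; case: (PHG) => _ GB _.
by apply: GB => //; apply: partial_hom0.
Qed.

Lemma partial_homD G x y : partial_hom G -> G x -> G y -> G (x + y).
Proof.
move=> PHG Gx Gy; rewrite -[y]opprK; case: (PHG) => _ GB _.
by apply: GB => //; apply: partial_homN.
Qed.

Lemma partial_homMn G x n : partial_hom G -> G x -> G (x *+ n).
Proof.
move=> PHG Gx; elim: n => [|n IH]; first by rewrite mulr0n; apply: partial_hom0.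
by rewrite mulrS; apply: partial_homD.
Qed.

Lemma partial_homMz G x (k : int) : partial_hom G -> G x -> G (x *~ k).
Proof.
by move=> PHG Gx; case: k => n; [|apply: partial_homN => //]; apply: partial_homMn.
Qed.

Lemma pairMz (x : B) (y : D) (k : int) : (x, y) *~ k = (x *~ k, y *~ k).
Proof.
have En n : (x, y) *+ n = (x *+ n, y *+ n) by elim: n => // n IH; rewrite !mulrS IH.
by case: k => n; rewrite /intmul En.
Qed.

(** Let [n] be the least positive integer with [b *+ n] in the domain. By Euclidean division every
    multiple of [b] in the domain is a multiple of [b *+ n], so dividing the value there by [n]
    gives [d]. If there is no such [n], only [k = 0] occurs and 0 will do. *)
Lemma partial_hom_value G (b : B) : partial_hom G ->
  exists d, forall (k : int) y, G (b *~ k, y) -> y = d *~ k.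
Proof.
move=> PHG; have [_ GB G1] := PHG.
pose p := [pred n | (0 < n)%N && `[< exists y, G (b *+ n, y) >]].
have pk (k : int) y : k != 0 -> G (b *~ k, y) -> p `|k|%N.
  move=> k0 Gk; rewrite /= absz_gt0 k0; apply/asboolP; exists (y *~ sgz k).
  have -> : b *+ `|k| = b *~ k *~ sgz k by rewrite -mulrzA mulrC -abszEsg.
  by rewrite -pairMz; apply: partial_homMz.
have [exp|nexp] := pselect (exists n, p n); last first.
  exists 0 => k y; have [->|k0] := eqVneq k 0; first by rewrite !mulr0z => /G1.
  by move/(pk _ _ k0) => ?; case: nexp; exists `|k|%N.
have [n /andP[n0 /asboolP[yn Gn]] nmin] := ex_minnP exp.
have [d dn] := divD yn n0; exists d => k y Gk.
have nz : n%:Z != 0 by rewrite -lt0n in n0 *; case: n n0 {Gn nmin dn}.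
have r0 : (k %% n)%Z = 0.
  apply/eqP/negPn/negP => r0.
  have : G (b *~ (k %% n)%Z, y - yn *~ (k %/ n)%Z).
    have -> : b *~ (k %% n)%Z = b *~ k - b *~ n *~ (k %/ n)%Z.
      by rewrite -mulrzA -mulrzBr /modz mulrC.
    rewrite -[(_, _)]/((_, _) - (_, _)) -pairMz.
    by apply: GB => //; apply: partial_homMz.
  move/(pk _ _ r0)/nmin; apply/negP; rewrite -ltnNge.
  have := ltz_pmod k (n0 : (0 < n%:Z)%R).
  by rewrite -[X in (X < _)%R]gez0_abs ?modz_ge0.
have kE : k = (k %/ n)%Z * n by rewrite [LHS](divz_eq k n) r0 addr0.
have /G1/eqP : G (0, y - yn *~ (k %/ n)%Z).
  have -> : 0 = b *~ k - b *~ n *~ (k %/ n)%Z by rewrite -mulrzA mulrC -kE subrr.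
  by rewrite -[(_, _)]/((_, _) - (_, _)) -pairMz; apply: GB => //; apply: partial_homMz.
by rewrite subr_eq0 => /eqP ->; rewrite -dn [in RHS]kE mulrC mulrzA.
Qed.

Lemma divisible_extension : exists h : {additive B -> D}, forall a, h (g a) = f a.
Proof.
have [F FP Ftot|G [PHG Gmax]] := @Zorn_bigcup (B * D)%type PG.
  move=> [x [X FX Xx]].
  have PX Y y : F Y -> Y y -> partial_hom Y by move=> FY Yy; apply: FP => //; exists y.
  have PHX := PX _ _ FX Xx; split.
  - by move=> a; exists X => //; case: PHX.
  - move=> y z [Y FY Yy] [Z FZ Zz].
    have [YZ|ZY] := Ftot _ _ FY FZ; [exists Z|exists Y] => //.
      by case: (PX _ _ FZ Zz) => _ ZB _; apply: ZB => //; apply: YZ.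
    by case: (PX _ _ FY Yy) => _ YB _; apply: YB => //; apply: ZY.
  - by move=> d [Y FY Yd]; case: (PX _ _ FY Yd) => _ _; apply.
pose G0 : set (B * D) := fun x => exists a, x = (g a, f a).
have PG0 : partial_hom G0.
  split=> [a|_ _ [a ->] [a' ->]|d [a [/esym ga ->]]]; first by exists a.
    by exists (a - a'); rewrite !raddfB.
  have -> : a = 0 by apply: ginj; rewrite ga raddf0.
  exact: raddf0.
(* A maximal [G] is not empty, since otherwise the graph [G0] would enlarge it. *)
have {}PHG : partial_hom G.
  apply: PHG; apply: contrapT => nG; apply: (Gmax G0) => //; split.
    by move=> x Gx; case: nG; exists x.
  by move=> G0G; apply: nG; exists 0; apply: G0G; apply: partial_hom0.
have [GG GB G1] := PHG.
have Gtot b : exists d, G (b, d).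
  have [d dP] := partial_hom_value b PHG; exists d.
  (* Adjoining the multiples of [(b, d)] keeps the graph single-valued by the choice of [d]. *)
  pose G' : set (B * D) := fun x =>
    exists2 y, G y & exists k : int, x = y + (b, d) *~ k.
  apply: contrapT => nGd; apply: (Gmax G').
    split=> [x Gx|/(_ (b, d)) G'bd].
      by exists x => //; exists 0; rewrite mulr0z addr0.
    apply: nGd; apply: G'bd; exists 0; first exact: partial_hom0.
    by exists 1; rewrite add0r.
  move=> _; split.
  - by move=> a; exists (g a, f a) => //; exists 0; rewrite mulr0z addr0.
  - move=> _ _ [y Gy [k ->]] [z Gz [l ->]]; exists (y - z); first exact: GB.
    by exists (k - l); rewrite mulrzBr opprD addrACA.
  - move=> e [[x y] Gxy [k]]; rewrite pairMz => -[/esym/eqP].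
    rewrite addr_eq0 -mulrNz => /eqP xE -> {e}.
    by rewrite xE in Gxy; rewrite (dP _ _ Gxy) mulrNz addNr.
have [h hG] := choice Gtot.
have hB : zmod_morphism h.
  move=> x y; apply/eqP; rewrite -subr_eq0; apply/eqP/G1.
  have -> : (0, h (x - y) - (h x - h y)) = (x - y, h (x - y)) - ((x, h x) - (y, h y)).
    by apply: injective_projections; rewrite /= ?subrr.
  by apply: (GB) => //; apply: GB.
exists (mkadditive hB) => a /=; apply/eqP; rewrite -subr_eq0; apply/eqP/G1.
have -> : (0, h (g a) - f a) = (g a, h (g a)) - (g a, f a).
  by apply: injective_projections; rewrite /= ?subrr.
exact: GB.
Qed.

End DivisibleExtension.

Lemma freeg_lift (T : choiceType) (A : zmodType) (f : T -> A) :
  exists h : {additive {freeg T} -> A}, forall t, h << t >> = f t.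
Proof.
have hB : zmod_morphism (fun w : {freeg T} => fglift (f : T -> zmodule A) w : A).
  by move=> x y; exact (lift_is_additive (f : T -> zmodule A) x y).
by exists (mkadditive hB) => t /=; rewrite liftU scale1r.
Qed.

Lemma freeg_ext (T : choiceType) (A : zmodType) (f g : {additive {freeg T} -> A}) :
  (forall t, f << t >> = g << t >>) -> forall w, f w = g w.
Proof.
move=> fg w; rewrite -[w]freeg_sumE !raddf_sum; apply: eq_bigr => t _ /=.
by rewrite -[coeff _ _]intz -freegU_mulz !raddfMz /= fg.
Qed.

(* N = Z^(N) / K embeds into the divisible group Q^(N) / K. *)
Lemma divisible_embedding (N : zmodType) :
  exists (D : zmodType) (j : {additive N -> D}), divisible D /\ injective j.
Proof.
pose L := free_lmod rat N.
pose delta (n : N) : L := @dsum_in _ _ (fun _ : N => rat^o) n 1.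
have [img imgE] := freeg_lift delta.
have [ev evE] := freeg_lift (id : N -> N).
have imgc w m : dsum_val (img w) m = (coeff m w)%:~R :> rat.
  have cB : zmod_morphism (fun w => (coeff m w)%:~R : rat).
    by move=> x y; rewrite raddfB /= rmorphB.
  have iB : zmod_morphism (fun w => dsum_val (img w) m : rat).
    by move=> x y; rewrite raddfB.
  apply: (@freeg_ext _ _ (mkadditive iB) (mkadditive cB)) => n /=.
  rewrite imgE coeffU mul1r; have [<-|nm] := eqVneq n m.
    by rewrite [LHS](@dsum_in_same _ _ (fun _ : N => rat^o)).
  rewrite [LHS](@dsum_in_neq _ _ (fun _ : N => rat^o)) //; exact/eqP.
have imgK n w : img w = delta n -> w = << n >>.
  move=> wn; apply/eqP/freeg_eqP => m.
  by apply: (@intr_inj rat); rewrite -!imgc wn imgE.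
have [|_ _ [v [<- v0]] [w [<- w0]]|D [q [sq qE]]] :=
  @quotient_zmod L (fun x => exists w, img w = x /\ ev w = 0).
- by exists 0; rewrite !raddf0.
- by exists (v - w); rewrite !raddfB /= v0 w0 subrr.
have jB : zmod_morphism (fun n => q (delta n)).
  move=> m n; apply/eqP; rewrite -subr_eq0 -!raddfB; apply/eqP/qE.
  exists (<< m - n >> - (<< m >> - << n >>)).
  by rewrite 2!(raddfB img) 2!(raddfB ev) !imgE !evE subrr.
exists D, (mkadditive jB); split=> [n d n0|m n /= mn].
  have [x <-] := sq d; exists (q (n%:R^-1 *: x)); rewrite -raddfMn.
  rewrite -scaler_nat scalerA divff ?scale1r //.
  by rewrite Num.Theory.pnatr_eq0 -lt0n.
apply/eqP; rewrite -subr_eq0; apply/eqP.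
have /qE[w [/imgK -> ]] : q (delta (m - n)) = 0.
  by have := jB m n => /= ->; rewrite mn subrr.
by rewrite evE.
Qed.

(** * Coinduced modules Hom_Z(S, D) *)

Section Coinduced.
Variables (S : pzRingType) (D : zmodType).

Record coind := Coind {
  coind_val :> S -> D;
  coind_valB : zmod_morphism coind_val
}.

HB.instance Definition _ := gen_eqMixin coind.
HB.instance Definition _ := gen_choiceMixin coind.

Lemma coind_ext (f g : coind) : f =1 g -> f = g.
Proof.
case: f g => [f fP] [g gP] /= /funext fg.
by case: _ / fg in gP *; congr Coind; apply: Prop_irrelevance.
Qed.

HB.instance Definition _ (f : coind) :=
  GRing.isZmodMorphism.Build S D f (coind_valB f).

Fact coind0B : zmod_morphism (fun _ : S => 0 : D).
Proof. by move=> x y; rewrite subr0. Qed.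
Fact coindNB (f : coind) : zmod_morphism (fun x => - f x).
Proof. by move=> x y; rewrite raddfB opprB opprK addrC. Qed.
Fact coindDB (f g : coind) : zmod_morphism (fun x => f x + g x).
Proof. by move=> x y; rewrite !raddfB opprD addrACA. Qed.
Fact coindZB (a : S) (f : coind) : zmod_morphism (fun x => f (x * a)).
Proof. by move=> x y; rewrite mulrBl raddfB. Qed.

Definition coind_zero := Coind coind0B.
Definition coind_opp f := Coind (coindNB f).
Definition coind_add f g := Coind (coindDB f g).
Definition coind_scale a f := Coind (coindZB a f).

Fact coind_addA : associative coind_add.
Proof. by move=> f g h; apply: coind_ext => x /=; rewrite addrA. Qed.
Fact coind_addC : commutative coind_add.
Proof. by move=> f g; apply: coind_ext => x /=; rewrite addrC. Qed.
Fact coind_add0 : left_id coind_zero coind_add.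
Proof. by move=> f; apply: coind_ext => x /=; rewrite add0r. Qed.
Fact coind_addN : left_inverse coind_zero coind_opp coind_add.
Proof. by move=> f; apply: coind_ext => x /=; rewrite addNr. Qed.

HB.instance Definition _ :=
  GRing.isZmodule.Build coind coind_addA coind_addC coind_add0 coind_addN.

Fact coind_scaleA a b f : coind_scale a (coind_scale b f) = coind_scale (a * b) f.
Proof. by apply: coind_ext => x /=; rewrite mulrA. Qed.
Fact coind_scale1 : left_id 1 coind_scale.
Proof. by move=> f; apply: coind_ext => x /=; rewrite mulr1. Qed.
Fact coind_scaleDr : right_distributive coind_scale +%R.
Proof. by move=> a f g; apply: coind_ext. Qed.
Fact coind_scaleDl f : {morph coind_scale^~ f : a b / a + b}.
Proof. by move=> a b; apply: coind_ext => x /=; rewrite mulrDr raddfD. Qed.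

HB.instance Definition _ := GRing.Zmodule_isLmodule.Build S coind
  coind_scaleA coind_scale1 coind_scaleDr coind_scaleDl.

(** Evaluation at 1 identifies S-linear maps into Hom_Z(S, D) with additive maps into [D], and these
    extend because [D] is divisible. *)
Lemma coind_injective : divisible D -> injective_module (coind : lmodType S).
Proof.
move=> divD A B g f gi.
have fB : zmod_morphism (fun a => f a 1) by move=> x y; rewrite linearB.
have gB : zmod_morphism (g : A -> B) by move=> x y; rewrite linearB.
have [h hE] := @divisible_extension A B D (mkadditive gB) (mkadditive fB) divD gi.
have kB b : zmod_morphism (fun x : S => h (x *: b)).
  by move=> x y; rewrite scalerBl raddfB.
have kL : linear (fun b => Coind (kB b)).
  move=> a x y; apply: coind_ext => s /=.
  by rewrite scalerDr scalerA raddfD.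
exists (mklinear kL) => a; apply: coind_ext => x /=.
by rewrite -linearZ hE /= linearZ /= mul1r.
Qed.

End Coinduced.

(** An embedding [j] of the additive group corresponds to [n |-> (x |-> j (x *: n))], which is
    injective by evaluation at 1. *)
Lemma injective_embedding (S : pzRingType) (N : lmodType S) :
  exists (E : lmodType S) (i : {linear N -> E}), injective_module E /\ injective i.
Proof.
have [D [j [divD ji]]] := divisible_embedding N.
have iB n : zmod_morphism (fun x : S => j (x *: n)).
  by move=> x y; rewrite scalerBl raddfB.
have iL : linear (fun n => Coind (iB n)).
  by move=> a x y; apply: coind_ext => s /=; rewrite scalerDr scalerA raddfD.
exists (coind S D : lmodType S), (mklinear iL); split; first exact: coind_injective.
move=> m n /(congr1 (fun f => coind_val f 1)) /=.
by rewrite !scale1r => /ji.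
Qed.

(** * Solving psi \o d = phi *)

Section LocalSolvability.
Variables (R : pzRingType) (P : lmodType R) (d : {linear P -> P}).

(** Exactness of Hom(P, F) at finite precision: the cocycle condition is tested on [S], the equation
    is solved on [T]. *)
Definition solvable_on (F : lmodType R) (T S : seq P) :=
  forall phi : {linear P -> F}, (forall s, s \in S -> phi (d s) = 0) ->
  exists psi : {linear P -> F}, forall t, t \in T -> psi (d t) = phi t.

Lemma pure_suml (M : lmodType R^c) (Q : lmodType R) (J : Type) (r : seq J)
    (x : J -> M) (q : Q) :
  \sum_(j <- r) pure (x j) q = pure (\sum_(j <- r) x j) q.
Proof.
elim: r => [|j r IH]; first by rewrite !big_nil pure0l.
by rewrite !big_cons pureDl IH.
Qed.

Lemma solvable_on_regular (T : seq P) :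
  projective P ->
  (forall E : lmodType R^c, injective_module E -> forall z : tensor E P,
     tensor_map d z = 0 -> exists w, tensor_map d w = z) ->
  exists S, solvable_on R^o T S.
Proof.
move=> pP exact_d.
pose t (j : 'I_(size T)) : P := nth 0 T j.
pose V : lmodType R^c := free_lmod R^c 'I_(size T).
pose W (v : V) :=
  exists psi : {linear P -> R^o}, forall j, dsum_val v j = psi (d (t j)).
have [||N [p [sp pW]]] := @quotient_lmod R^c V W.
- have oL : linear (fun _ : P => 0 : R^o) by move=> a x y; rewrite scaler0 addr0.
  by exists (mklinear oL) => j.
- move=> a x y [psi psiE] [psi' psi'E].
  (* A scalar of [R^c] acts by right multiplication, which preserves left linearity. *)
  have L : linear (fun q : P => psi q * (a : R) + psi' q : R^o).
    move=> b u v; rewrite !linearP scalerDr mulrDl addrACA.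
    by congr (_ + _ + _); exact/esym/mulrA.
  exists (mklinear L) => j /=.
  by rewrite -psiE -psi'E.
have [E [i [Einj ii]]] := injective_embedding N.
pose one j : V := @dsum_in _ _ (fun _ => R^c^o) j 1.
pose x j := i (p (one j)).
have ipE (v : V) : i (p v) = \sum_j ((dsum_val v j : R) : R^c) *: x j.
  rewrite [in LHS](@dsum_sum _ _ _ v (index_enum _)) ?index_enum_uniq //; last first.
    by move=> j; rewrite mem_index_enum.
  rewrite !linear_sum; apply: eq_bigr => j _.
  suff -> : @dsum_in R^c _ (fun _ => R^c^o) j (dsum_val v j)
      = ((dsum_val v j : R) : R^c) *: one j.
    by rewrite 2!linearZ.
  apply: dsum_ext => k; rewrite [RHS]/=; have [<-|jk] := pselect (j = k).
    rewrite dsum_in_fun_same [LHS](@dsum_in_same _ _ (fun _ => R^c^o)).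
    exact: (esym (@mulr1 R^c (dsum_val v j))).
  rewrite dsum_in_fun_neq // [LHS](@dsum_in_neq _ _ (fun _ => R^c^o)) //.
  exact/esym/scaler0.
pose z : tensor E P := \sum_j pure (x j) (t j).
have dz : tensor_map d z = 0.
  (* It suffices to test against functionals [psi]. The result is the sum of the [x j] scaled by
     [psi (d (t j))], tensored with 1; that sum is the image of an element of [W], hence 0. *)
  apply: (tensor_projective_eq0 pP) => psi.
  rewrite /z !raddf_sum /=.
  under eq_bigr => j _.
    rewrite !tensor_map_pure.
    have -> : psi (d (t j)) = (psi (d (t j)) : R) *: (1 : R^o).
      by rewrite /GRing.scale /= mulr1.
    rewrite -pureZ; over.
  rewrite pure_suml.
  have [v vE] := @dsum_build R^c _ (fun _ => R^c^o)
    (fun j : 'I_(size T) => psi (d (t j)))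
    (enum 'I_(size T)) (fun i => ltac:(by rewrite mem_enum)).
  under eq_bigr => j _ do rewrite -vE.
  rewrite -ipE; have /pW -> : W v by exists psi => j; apply: vE.
  by rewrite linear0 pure0l.
have [w wz] := exact_d E Einj z dz.
have [s sE] := tensor_sum w.
(* The set [S] consists of the elements of [P] that occur in a primitive [w] of [z]. *)
exists [seq y.2 | y <- s] => phi phi0.
have [ev evE] := tensor_eval E phi.
have [v vE] := @dsum_build R^c _ (fun _ => R^c^o) (fun j : 'I_(size T) => phi (t j))
    (enum 'I_(size T)) (fun i => ltac:(by rewrite mem_enum)).
(* Evaluating [z] at [phi] gives the class of the vector of all [phi (t j)]. It vanishes because [z]
   is the boundary of [w] and [phi \o d] is 0 on [S]; so the vector lies in [W], which provides
   [psi]. *)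
have : ev z = 0.
  rewrite -wz sE !raddf_sum big_seq big1 // => y ys /=.
  by rewrite tensor_map_pure evE phi0 ?scale0r //; apply: map_f.
rewrite /z raddf_sum.
under eq_bigr => j _ do rewrite /= evE -vE.
rewrite -ipE -[0](linear0 i) => /ii/pW[psi psiE].
exists psi => q qT; have qi : (index q T < size T)%N by rewrite index_mem.
have -> : q = t (Ordinal qi) by rewrite /t /= nth_index.
by rewrite -psiE vE.
Qed.

(** The equation is solved coordinatewise, with the same [S] for every coordinate. Only the finitely
    many coordinates in [bs] occur on [T]; the others get the zero solution, so that the family maps
    into the direct sum. *)
Lemma solvable_on_free (B : choiceType) T S :
  solvable_on R^o T S -> solvable_on (free_lmod R B) T S.
Proof.
move=> gTS phi phi0.
pose pr b : {linear free_lmod R B -> R^o} := @dsum_proj R B (fun _ => R^o) b.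
have h b : exists psi : {linear P -> R^o},
    forall t, t \in T -> psi (d t) = pr b (phi t).
  by apply: (gTS (pr b \o phi)) => s sS /=; rewrite phi0 // linear0.
pose bs := flatten [seq dsum_supp (phi t) | t <- T].
have h' b : exists psi : {linear P -> R^o},
    (forall t, t \in T -> psi (d t) = pr b (phi t)) /\
    (b \notin bs -> forall p, psi p = 0).
  have [bbs|bbs] := boolP (b \in bs); first by have [psi] := h b; exists psi.
  have oL : linear (fun _ : P => 0 : R^o) by move=> a x y; rewrite scaler0 addr0.
  exists (mklinear oL); split=> // t tT; apply/esym/dsum_suppN.
  by apply: contra bbs => bt; apply/flattenP; exists (dsum_supp (phi t)) => //;
    exact: (map_f (fun t => dsum_supp (phi t))).
have [psi psiE] := choice h'.
have build p : exists y : free_lmod R B, forall b, dsum_val y b = psi b p.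
  apply: (@dsum_build R B (fun _ => R^o) (fun b => psi b p) bs) => b bbs.
  by have [_ ->] := psiE b.
have [Psi PsiE] := choice build.
have PL : linear Psi.
  move=> a x y; apply: dsum_ext => b; rewrite [LHS]PsiE.
  by rewrite [RHS]/= !PsiE linearP.
exists (mklinear PL) => t tT; apply: dsum_ext => b.
by rewrite [LHS]PsiE; have [->] := psiE b.
Qed.

Lemma solvable_on_projective (F : lmodType R) T S :
  projective F -> solvable_on R^o T S -> solvable_on F T S.
Proof.
move=> /projective_free[s [r rs]] /(@solvable_on_free F) gTS phi phi0.
have [|psi psiE] := gTS (s \o phi).
  by move=> x xS /=; rewrite phi0 // linear0.
by exists (r \o psi) => t tT /=; rewrite psiE //= rs.
Qed.

End LocalSolvability.

(** [L] extends an arbitrary function linearly from a generating set and restricts along a section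
    of the free cover. Its value at [p] uses the function on the finite list [supp p] only, so
    linear maps can be redefined or glued on sets closed under [supp]. *)
Lemma dual_basis (R : pzRingType) (P F : lmodType R) : projective P ->
  exists (supp : P -> seq P) (L : (P -> F) -> {linear P -> F}),
    (forall g g' p, (forall b, b \in supp p -> g b = g' b) -> L g p = L g' p) /\
    (forall (psi : {linear P -> F}) p, L psi p = psi p).
Proof.
move=> pP; pose f (b : P) : {linear R^o -> P} := mklinear (scale_elt_linear b).
have sf : surj (dsum_out f).
  move=> b; exists (@dsum_in _ _ (fun _ => R^o) b 1).
  by rewrite [LHS](dsum_out_in f) /= scale1r.
have [s sK] := pP _ _ (dsum_out f) idfun sf.
pose h (g : P -> F) b : {linear R^o -> F} := mklinear (scale_elt_linear (g b)).
exists (fun p => dsum_supp (s p)), (fun g => dsum_out (h g) \o s); split.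
  move=> g g' p gg'; rewrite /= /dsum_out !big_seq; apply: eq_bigr => b bp /=.
  by rewrite gg'.
move=> psi p; have E : dsum_out f (s p) = p := sK p.
rewrite -[in RHS]E /= /dsum_out linear_sum.
by apply: eq_bigr => b _ /=; rewrite linearZ.
Qed.

(** * From local to global solvability *)

Section GlobalSolvability.
Variables (R : pzRingType) (P F : lmodType R) (d : {linear P -> P}).
Hypothesis dd : forall p, d (d p) = 0.
Hypothesis local : forall T, exists S, solvable_on d F T S.
Variables (supp : P -> seq P) (L : (P -> F) -> {linear P -> F}).
Hypothesis L_eq : forall g g' p,
  (forall b, b \in supp p -> g b = g' b) -> L g p = L g' p.
Hypothesis L_id : forall (psi : {linear P -> F}) p, L psi p = psi p.

Lemma L_agree (g : P -> F) (psi : {linear P -> F}) p :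
  (forall b, b \in supp p -> g b = psi b) -> L g p = psi p.
Proof. by move/L_eq ->; apply: L_id. Qed.

Lemma supp_vanish (psi : {linear P -> F}) p :
  (forall b, b \in supp p -> psi b = 0) -> psi p = 0.
Proof.
move=> p0; have oL : linear (fun _ : P => 0 : F).
  by move=> a x y; rewrite scaler0 addr0.
rewrite -L_id (@L_eq _ (mklinear oL)) ?L_id //.
Qed.

(** For [p] in [C], the first two clauses let values on [C] determine a map at [p] and at [d p]; the
    third keeps the finite test sets inside [C]. *)
Definition locally_closed (C : P -> Prop) :=
  [/\ forall p b, C p -> b \in supp p -> C b,
      forall p b, C p -> b \in supp (d p) -> C b &
      forall T, (forall t, t \in T -> C t) ->
      exists2 S, (forall s, s \in S -> C s) & solvable_on d F T S].

Section Extension.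
Variables (C : P -> Prop) (phi : {linear P -> F}) (p0 : P).
Hypothesis Ccl : locally_closed C.

(* Solvability relative to C: given psi solving on T and U T, the map psi \o d
   vanishes on U T, so some theta \o d agrees with psi on the part of C supporting
   d T; psi - theta \o d can then be redefined as 0 on all of C. *)
Lemma quotient_local : exists U S : seq P -> seq P,
  [/\ forall T u, u \in U T -> C u &
   forall T (chi : {linear P -> F}), (forall u, u \in U T -> chi u = 0) ->
     (forall s, s \in S T -> chi (d s) = 0) ->
   exists psi : {linear P -> F},
     (forall c, C c -> psi c = 0) /\ (forall t, t \in T -> psi (d t) = chi t)].
Proof.
have [C1 C2 C3] := Ccl.
pose X T := [seq b <- flatten [seq supp (d t) | t <- T] | `[< C b >]].
have exU T : exists U, (forall u, u \in U -> C u) /\ solvable_on d F (X T) U.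
  have [|U] := C3 (X T); last by exists U.
  by move=> t; rewrite mem_filter => /andP[/asboolP].
have [U UP] := choice exU.
have [S SP] := choice (fun T => local (T ++ U T)).
exists U, S; split=> [T u|T chi chiU chiS]; first by have [UC _] := UP T; apply: UC.
have [_ gU] := UP T.
have [psi psiE] := SP T chi chiS.
have [u uU|theta thetaE] := gU psi.
  by rewrite psiE ?chiU // mem_cat uU orbT.
pose psi2 : {linear P -> F} := psi \- (theta \o d).
pose psi3 := L (fun b => if `[< C b >] then 0 else psi2 b).
exists psi3; split=> [c Cc|t tT].
  rewrite /psi3 (@L_agree _ \0) // => b bc.
  by have /asboolP -> := C1 _ _ Cc bc.
rewrite /psi3 (@L_agree _ psi2).
  by rewrite /= dd linear0 subr0 psiE // mem_cat tT.
move=> b bt; case: asboolP => // Cb /=.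
rewrite thetaE ?subrr // mem_filter; apply/andP; split; first exact/asboolP.
by apply/flattenP; exists (supp (d t)) => //; apply: map_f.
Qed.

Hypothesis phiC : forall c, C c -> phi c = 0.
Hypothesis phid : forall p, phi (d p) = 0.

(* Mittag-Leffler: C' is C together with the union of an increasing sequence of
   finite sets T k.  The solution psi_k on T (k + 1) can be corrected, without
   changing psi_k \o d, so as to agree with psi_(k-1) on T (k - 1), because
   S (T (k - 1)) is contained in T k. *)
Lemma closed_extension : exists C' : P -> Prop,
  [/\ forall c, C c -> C' c, C' p0, locally_closed C' &
   exists psi : {linear P -> F},
    (forall c, C c -> psi c = 0) /\ (forall c, C' c -> psi (d c) = phi c)].
Proof.
have [C1 C2 C3] := Ccl.
have [U [S [UC US]]] := quotient_local.
have d_vanish (psi : {linear P -> F}) : (forall c, C c -> psi c = 0) ->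
    forall c, C c -> psi (d c) = 0.
  by move=> psi0 c Cc; apply: supp_vanish => b /(C2 _ _ Cc); apply: psi0.
(* The three added lists serve the three clauses of [locally_closed], in order. *)
pose next T := T ++ flatten (map supp T) ++ flatten [seq supp (d t) | t <- T] ++ S T.
pose T k := iter k next [:: p0].
have TT k : {subset T k <= T k.+1} by move=> t tk; rewrite /= /next mem_cat tk.
have Tle k l : (k <= l)%N -> {subset T k <= T l}.
  elim: l => [|l IH]; first by rewrite leqn0 => /eqP ->.
  by rewrite leq_eqVlt => /predU1P[-> //|/IH kl t /kl/TT].
have Tsupp k t b : t \in T k -> b \in supp t -> b \in T k.+1.
  move=> tk bt; rewrite /= /next !mem_cat; apply/orP; right; apply/orP; left.
  by apply/flattenP; exists (supp t) => //; apply: map_f.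
have Tdsupp k t b : t \in T k -> b \in supp (d t) -> b \in T k.+1.
  move=> tk bt; rewrite /= /next !mem_cat; do 2![apply/orP; right]; apply/orP; left.
  by apply/flattenP; exists (supp (d t)) => //; apply: (map_f (fun t => supp (d t))).
have TS k s : s \in S (T k) -> s \in T k.+1.
  by move=> sk; rewrite /= /next !mem_cat sk !orbT.
exists (fun p => C p \/ exists k, p \in T k); split.
- by left.
- by right; exists 0%N; rewrite inE.
- split=> [p b [Cp|[k pk]] bp|p b [Cp|[k pk]] bp|V VC].
  + by left; apply: C1 Cp bp.
  + by right; exists k.+1; apply: Tsupp bp.
  + by left; apply: C2 Cp bp.
  + by right; exists k.+1; apply: Tdsupp bp.
  have [k kV] : exists k, forall t, t \in V -> C t \/ t \in T k.
    elim: V VC => [|v V IH] VC; first by exists 0%N.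
    have [|k kV] := IH; first by move=> t tV; apply: VC; rewrite inE tV orbT.
    have [Cv|[l vl]] := VC v (mem_head _ _).
      by exists k => t; rewrite inE => /predU1P[->|/kV //]; left.
    exists (maxn k l) => t; rewrite inE => /predU1P[->|/kV[|tk]]; [right|by left|right].
      exact: Tle (leq_maxr _ _) _ vl.
    exact: Tle (leq_maxl _ _) _ tk.
  pose V0 := [seq v <- V | `[< C v >]].
  have [|S0 S0C S0g] := C3 (V0 ++ U (T k)).
    by move=> t; rewrite mem_cat mem_filter => /orP[/andP[/asboolP]|/UC].
  exists (S0 ++ S (T k)).
    by move=> s; rewrite mem_cat => /orP[/S0C|/TS]; [left|right; exists k.+1].
  move=> chi chi0.
  (* Solve inside [C] first, on [V0] and on [U (T k)]. The remainder [chi \- (psi1 \o d)] then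
     vanishes on [U (T k)], and it is solved on [T k] by a map that is 0 on [C]. *)
  have [s sS0|psi1 psi1E] := S0g chi; first by apply: chi0; rewrite mem_cat sS0.
  have [u uU|s sS|psi2 [psi2C psi2E]] := US (T k) (chi \- (psi1 \o d)).
  + by rewrite /= psi1E ?subrr // mem_cat uU orbT.
  + by rewrite /= dd linear0 subr0 chi0 // mem_cat sS orbT.
  exists (psi1 \+ psi2) => t tV /=.
  have [Ct|Ct] := pselect (C t).
    rewrite (d_vanish psi2) // addr0 psi1E // mem_cat mem_filter tV andbT.
    by apply/orP; left; apply/asboolP.
  by have [//|tk] := kV t tV; rewrite psi2E //= addrC subrK.
pose A k (psi : {linear P -> F}) :=
  (forall c, C c -> psi c = 0) /\ (forall t, t \in T k.+1 -> psi (d t) = phi t).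
have exA k : exists psi, A k psi.
  by apply: US => [u /UC|s _]; [apply: phiC|apply: phid].
have stepA k psi : A k psi ->
    exists psi', A k.+1 psi' /\ forall t, t \in T k -> psi' t = psi t.
  move=> [psiC psid]; have [chi [chiC chid]] := exA k.+1.
  have [u /UC Cu|s /TS sT|theta [thetaC thetaE]] := US (T k) (chi \- psi).
  - by rewrite /= chiC ?psiC ?subrr.
  - by rewrite /= psid // chid ?subrr //; apply: TT.
  exists (chi \- (theta \o d)); split; first split.
  - by move=> c Cc /=; rewrite chiC // d_vanish // subrr.
  - by move=> t tk /=; rewrite dd linear0 subr0 chid.
  - by move=> t tk /=; rewrite thetaE //= opprB addrC subrK.
pose next_psi k (x : {psi | A k psi}) : {psi | A k.+1 psi} :=
  let: exist psi Apsi := x in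
  let: exist psi' Apsi' := cid (stepA k psi Apsi) in exist _ psi' Apsi'.1.
pose Psi := fix Psi k : {psi | A k psi} :=
  if k is k'.+1 then next_psi k' (Psi k') else
  let: exist psi Apsi := cid (exA 0%N) in exist _ psi Apsi.
have PsiS k t : t \in T k -> sval (Psi k.+1) t = sval (Psi k) t.
  move=> tk /=; case: (Psi k) => psi Apsi /=.
  by case: cid => psi' [A' E] /=; apply: E.
have Psile k l t : (k <= l)%N -> t \in T k -> sval (Psi l) t = sval (Psi k) t.
  elim: l => [|l IH]; first by rewrite leqn0 => /eqP ->.
  rewrite leq_eqVlt => /predU1P[-> //|kl] tk.
  by rewrite PsiS ?IH //; apply: Tle tk.
(* The limit of the [Psi k], extended by 0; it is merely a function, and [L] makes it linear. *)
pose g b := if pselect (exists k, b \in T k) is left e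
  then sval (Psi (sval (cid e))) b else 0.
have gE k b : b \in T k -> g b = sval (Psi k) b.
  move=> bk; rewrite /g; case: pselect => [e|[]]; last by exists k.
  case: cid => l /= bl; have [kl|/ltnW lk] := leqP k l.
    by rewrite (Psile _ _ _ kl).
  by rewrite (Psile _ _ _ lk).
have gC c : C c -> g c = 0.
  move=> Cc; rewrite /g; case: pselect => // e.
  by case: (Psi _) => psi [psiC _] /=; apply: psiC.
have LgC c : C c -> L g c = 0.
  by move=> Cc; rewrite (@L_agree _ \0) // => b /(C1 _ _ Cc)/gC.
exists (L g); split=> // c [Cc|[k ck]].
  by rewrite d_vanish // phiC.
(* For [c] in [T k], the support of [d c] lies in [T k.+1], where [g] is [Psi k.+1]; this solves the
   equation on [T k.+2], which contains [c]. *)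
rewrite (@L_agree _ (sval (Psi k.+1))) => [|b /(Tdsupp _ _ _ ck)/gE //].
have ck2 : c \in T k.+2 by apply/TT/TT.
by case: (Psi k.+1) => psi' [_ psid] /=; apply: psid.
Qed.

End Extension.

(** Zorn's lemma runs over graphs of partial solutions on locally closed domains. Each is the
    restriction of a linear map on all of [P], whose values off the domain stay free. *)
Lemma global_solvability (phi : {linear P -> F}) :
  (forall p, phi (d p) = 0) ->
  exists psi : {linear P -> F}, forall p, psi (d p) = phi p.
Proof.
move=> phid.
pose dom (G : set (P * F)) p := exists f, G (p, f).
pose solves (G : set (P * F)) := locally_closed (dom G) /\
  exists psi : {linear P -> F},
  (forall x, G x -> x.2 = psi x.1) /\ (forall p, dom G p -> psi (d p) = phi p).
have [X XS Xtot|G [[Gcl [psi [psiG psid]]] Gmax]] := @Zorn_bigcup _ solves.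
  pose G := (\bigcup_(Y in X) Y)%classic.
  have subG Y p : X Y -> dom Y p -> dom G p by move=> XY [f Yf]; exists f, Y.
  pose g p := if pselect (dom G p) is left e then sval (cid e) else 0.
  have gE Y (psi : {linear P -> F}) p : X Y -> (forall x, Y x -> x.2 = psi x.1) ->
      dom Y p -> g p = psi p.
    move=> XY Ypsi [f Yf]; rewrite /g; case: pselect; last by case; exists f, Y.
    move=> e; case: cid => f' /= [Z XZ Zf'].
    have [_ [psi' [Zpsi _]]] := XS _ XZ.
    have [YZ|ZY] := Xtot _ _ XY XZ; last exact: (Ypsi _ (ZY _ Zf')).
    have /= -> := Zpsi _ Zf'; have /= <- := Ypsi _ Yf.
    by have /= -> := Zpsi _ (YZ _ Yf).
  have agree Y (psi : {linear P -> F}) p : X Y -> (forall x, Y x -> x.2 = psi x.1) ->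
      (forall b, b \in supp p -> dom Y b) -> L g p = psi p.
    by move=> XY Ypsi Yp; apply: L_agree => b /Yp/(gE Y psi); apply.
  split.
    split=> [p b [f [Y XY Yf]] bp|p b [f [Y XY Yf]] bp|T TG].
    - apply: (subG Y) => //; have [[Y1 _ _] _] := XS _ XY.
      by apply: Y1 bp; exists f.
    - apply: (subG Y) => //; have [[_ Y2 _] _] := XS _ XY.
      by apply: Y2 bp; exists f.
    (* The empty [T] is separate: the chain may be empty and then has no member [Y] to offer. *)
    case: T TG => [|t T] TG; first by exists [::] => // chi _; exists chi.
    have [Y XY TY] : exists2 Y, X Y & forall u, u \in t :: T -> dom Y u.
      elim: T t TG => [|u T IH] t TG.
        have [f [Y XY Yf]] := TG t (mem_head _ _).
        by exists Y => // u; rewrite inE => /eqP ->; exists f.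
      have [|Y XY TY] := IH u; first by move=> v vT; apply: TG; rewrite inE vT orbT.
      have [f [Z XZ Zf]] := TG t (mem_head _ _).
      have [YZ|ZY] := Xtot _ _ XY XZ; [exists Z|exists Y] => // v.
        rewrite inE => /predU1P[->|/TY[f' Yf']]; first by exists f.
        by exists f'; apply: YZ.
      rewrite inE => /predU1P[->|/TY//]; exists f; exact: ZY.
    have [[_ _ Y3] _] := XS _ XY; have [S SY Sg] := Y3 _ TY.
    by exists S => // s /SY; apply: subG.
  exists (L g); split=> [[p f] [Y XY Yf]|p [f [Y XY Yf]]];
    have [[Y1 Y2 _] [psi [Ypsi Yd]]] := XS _ XY; have Yp : dom Y p by exists f.
  - by rewrite /= (agree Y psi) // => [|b /(Y1 _ _ Yp)]//; apply: (Ypsi _ Yf).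
  - by rewrite (agree Y psi) ?Yd // => b /(Y2 _ _ Yp).
suff domG p : dom G p by exists psi => p; apply: psid.
apply: contrapT => Gp.
(* The error of the maximal solution vanishes on its domain and is still a cocycle, so it can be
   solved on a larger domain by a map that is 0 on the old one. *)
pose phi' : {linear P -> F} := phi \- (psi \o d).
have [c Gc|q|C' [GC' C'p C'cl [psi' [psi'G psi'd]]]] :=
  @closed_extension (dom G) phi' p Gcl.
- by rewrite /= psid // subrr.
- by rewrite /= dd linear0 subr0 phid.
pose G' : set (P * F) := fun x => C' x.1 /\ x.2 = (psi \+ psi') x.1.
have domG' q : dom G' q <-> C' q.
  by split=> [[f []] //|C'q]; exists ((psi \+ psi') q).
apply: (Gmax G'); first split.
- move=> [q f] Gqf; have Gq : dom G q by exists f.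
  split; first exact: GC'.
  by rewrite /= psi'G // addr0; apply: (psiG _ Gqf).
- move=> G'G; apply: Gp; exists ((psi \+ psi') p); apply: G'G.
  by split.
split.
  by have -> : dom G' = C' by apply/funext => q; apply/propext.
exists (psi \+ psi'); split=> [x []//|q /domG' C'q].
by rewrite /= psi'd //= addrC subrK.
Qed.

End GlobalSolvability.

(** * Tor and Ext in degree one *)

Section Acyclicity.
Variable R : pzRingType.
Implicit Types A B C K Q X F : lmodType R.

(* For X to be [tor_acyclic] means Tor_1(E, X) = 0 for all injective E; to be
   [ext_acyclic] means Ext^1(X, F) = 0 for all projective F. *)
Definition tensor_exact A B (i : {linear A -> B}) :=
  forall E : lmodType R^c, injective_module E ->
  injective (tensor_map i : tensor E A -> tensor E B).

Definition tor_acyclic X := forall A B (i : {linear A -> B}) (p : {linear B -> X}),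
  ses i p -> tensor_exact i.

Definition ext_acyclic X := forall F A B (i : {linear A -> B}) (p : {linear B -> X}),
  projective F -> ses i p ->
  forall f : {linear A -> F}, exists g : {linear B -> F}, forall a, g (i a) = f a.

Fact pairl_linear A B : linear (fun a : A => (a, 0 : B)).
Proof.
by move=> a x y; apply: injective_projections; rewrite /= ?scaler0 ?addr0.
Qed.
Definition pairl A B : {linear A -> (A * B)%type} := mklinear (@pairl_linear A B).

(* With h : Q -> B lifting q and u : K -> A induced by h, B is the quotient of
   A * Q by K, for an arbitrary sequence 0 -> A -> B -> X -> 0. *)
Lemma ses_pushout K Q X A B (k : {linear K -> Q}) (q : {linear Q -> X})
    (i : {linear A -> B}) (p : {linear B -> X}) :
  projective Q -> ses k q -> ses i p ->
  exists (u : {linear K -> A}) (kap : {linear K -> (A * Q)%type})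
    (pi : {linear (A * Q)%type -> B}),
  [/\ ses kap pi, forall c, kap c = (- u c, k c) & forall a, pi (a, 0) = i a].
Proof.
move=> pQ kq ip; have [ik ekq sq] := kq; have [ii eip sp] := ip.
have [h hE] := pQ _ _ p q sp.
have [|u uE] := @factor_inj _ _ _ _ i (h \o k) ii.
  by move=> c; apply/eip; rewrite /= hE (ses_comp _ kq).
have kapL : linear (fun c => (- u c, k c)).
  move=> a x y; apply: injective_projections; rewrite /= linearP //.
  by rewrite opprD scalerN.
have piL : linear (fun z : (A * Q)%type => i z.1 + h z.2).
  by move=> a x y; rewrite !linearP /= scalerDr addrACA.
exists u, (mklinear kapL), (mklinear piL); split=> //; last first.
  by move=> a /=; rewrite linear0 addr0.
split=> [x y [_ /ik]//|[a x]|b].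
- split=> /= [axE|[c [<- <-]]]; last by rewrite linearN uE /= addNr.
  have /ekq[c kc] : q x = 0.
    have /(congr1 p) := axE; rewrite linearD hE linear0.
    by rewrite (ses_comp _ ip) add0r.
  exists c; congr (_, _) => //; apply: ii; rewrite linearN uE /= kc.
  by apply/eqP; rewrite eq_sym -addr_eq0 axE.
- have [x qx] := sq (p b).
  have /eip[a ia] : p (b - h x) = 0 by rewrite linearB hE qx subrr.
  by exists (a, x); rewrite /= ia subrK.
Qed.

(** One projective presentation suffices. If [z] dies in B, then [(z, 0)] comes from some [w] over
    [K]; its component over [Q] is 0, so [w] is 0 by exactness of [k], and hence [z] is 0. *)
Lemma tor_acyclicI K Q X (k : {linear K -> Q}) (q : {linear Q -> X}) :
  projective Q -> ses k q -> tensor_exact k -> tor_acyclic X.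
Proof.
move=> pQ kq tk A B i p ip E injE; apply: tensor_map_inj => z iz.
have [u [kap [pi [kp kapE piE]]]] := ses_pushout pQ kq ip.
have [_ ekp sp] := kp.
have [|w wE] := @tensor_right_exact _ E _ _ _ kap pi ekp sp (tensor_map (pairl A Q) z).
  by rewrite (@tensor_map_comp _ _ _ _ _ _ _ i).
have w0 : w = 0.
  apply: (tk E injE); rewrite raddf0.
  rewrite -(@tensor_map_comp _ _ _ _ _ kap (@snd A Q)); last by move=> c; rewrite kapE.
  rewrite wE (@tensor_map_comp _ _ _ _ _ _ _ (@snd A Q \o pairl A Q)) //.
  by apply: tensor_map0.
rewrite -[z](@tensor_map_id _ _ _ (@fst A Q \o pairl A Q)) //.
rewrite -(@tensor_map_comp _ _ _ _ _ (pairl A Q) (@fst A Q)) //.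
by rewrite -wE w0 !raddf0.
Qed.

(** Extend [f \o u] along [k] to [g]; then [f] and [g] together kill [K] and descend from A * Q to
    B. *)
Lemma ext_acyclicI K Q X (k : {linear K -> Q}) (q : {linear Q -> X}) :
  projective Q -> ses k q ->
  (forall F (f : {linear K -> F}), projective F ->
     exists g : {linear Q -> F}, forall c, g (k c) = f c) ->
  ext_acyclic X.
Proof.
move=> pQ kq ek F A B i p pF ip f.
have [u [kap [pi [[_ ekp sp] kapE piE]]]] := ses_pushout pQ kq ip.
have [g gE] := ek F (f \o u) pF.
have GL : linear (fun z : (A * Q)%type => f z.1 + g z.2).
  by move=> a x y; rewrite !linearP /= scalerDr addrACA.
have [|G GE] := @factor_surj _ _ _ _ pi (mklinear GL) sp.
  by move=> z /ekp[c <-]; rewrite kapE /= linearN gE addNr.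
by exists G => a; rewrite -piE GE /= linear0 addr0.
Qed.

(** Pull the sequence back along [r] to one ending in [Y]. The section [s] gives a map from B to the
    pullback that is the identity on A, so injectivity after tensoring passes to [i]. *)
Lemma tor_acyclic_retract X Y : retract_of X Y -> tor_acyclic Y -> tor_acyclic X.
Proof.
move=> [s [r rs]] tY A B i p ip E injE.
have [ii eip sp] := ip.
have [C [j [ij ej]]] := @kernel_lmod R (B * Y)%type X
  ((p \o @fst B Y) \- (r \o @snd B Y)).
have jE z : p z.1 = r z.2 <-> exists c, j c = z.
  rewrite -ej /=; split=> [->|/eqP]; first by rewrite subrr.
  by rewrite subr_eq0 => /eqP.
have [|h hE] := @factor_inj _ _ _ _ j (pairl B Y \o i) ij.
  by move=> a; apply/jE; rewrite /= (ses_comp _ ip) linear0.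
have fL : linear (fun b => (b, s (p b))).
  by move=> a x y; apply: injective_projections; rewrite /= ?linearP.
have [|f fE] := @factor_inj _ _ _ _ j (mklinear fL) ij.
  by move=> b; apply/jE; rewrite /= rs.
have hf a : f (i a) = h a.
  by apply: ij; rewrite hE fE /= (ses_comp _ ip) linear0.
have hses : ses h (@snd B Y \o j).
  split=> [x y /(congr1 j)|c|y].
  - by rewrite !hE => -[/ii].
  - split=> [/= jc2|[a <-]]; last by rewrite /= hE.
    have /eip[a aE] : p (j c).1 = 0.
      by have /jE -> : exists c', j c' = j c; [exists c|rewrite jc2 linear0].
    exists a; apply: ij; rewrite hE /= aE -jc2; by case: (j c).
  - have [b bE] := sp (r y); have /jE[c cE] : p (b, y).1 = r (b, y).2 by [].
    by exists c; rewrite /= cE.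
apply: tensor_map_inj => z iz; apply: (tY _ _ _ _ hses E injE).
by rewrite raddf0 -(@tensor_map_comp _ _ _ _ _ i f) // iz raddf0.
Qed.

(** [L] is the preimage of [A] under [q]: the kernel of the composite onto [C], and an extension of
    [A] by [K]. *)
Lemma ses_preimage K Q A B C (i : {linear A -> B}) (p : {linear B -> C})
    (k : {linear K -> Q}) (q : {linear Q -> B}) :
  ses i p -> ses k q ->
  exists (L : lmodType R) (l : {linear L -> Q}) (n : {linear K -> L})
    (m : {linear L -> A}),
  [/\ ses l (p \o q), ses n m & forall x, l (n x) = k x].
Proof.
move=> ip kq; have [ii eip sp] := ip; have [ik ekq sq] := kq.
have [L [l [il el]]] := kernel_lmod (p \o q).
have lq : ses l (p \o q).
  by split=> // c; have [b <-] := sp c; have [x <-] := sq b; exists x.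
have [|m mE] := @factor_inj _ _ _ _ i (q \o l) ii.
  by move=> x; apply/eip; have := ses_comp x lq.
have [|n nE] := @factor_inj _ _ _ _ l k il.
  by move=> x; apply/el; rewrite /= (ses_comp _ kq) linear0.
exists L, l, n, m; split=> //; split=> [x y /(congr1 l)|x|a].
- by rewrite !nE => /ik.
- split=> [mx|[c <-]]; last by apply: ii; rewrite mE /= nE (ses_comp _ kq) linear0.
  have /ekq[c cE] : q (l x) = 0 by have := mE x; rewrite mx linear0.
  by exists c; apply: il; rewrite nE.
- have [x xE] := sq (i a).
  have /el[y yE] : (p \o q) x = 0 by rewrite /= xE (ses_comp _ ip).
  by exists y; apply: ii; rewrite mE /= yE.
Qed.

(** The inclusion of [K] in [Q] is the composite of two inclusions with cokernels [A] and [C]. *)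
Lemma tor_acyclic_ext A B C (i : {linear A -> B}) (p : {linear B -> C}) :
  ses i p -> tor_acyclic A -> tor_acyclic C -> tor_acyclic B.
Proof.
move=> ip tA tC K Q k q kq E injE.
have [L [l [n [m [lq nm nE]]]]] := ses_preimage ip kq.
apply: tensor_map_inj => z kz.
apply: (tA _ _ _ _ nm E injE); rewrite raddf0; apply: (tC _ _ _ _ lq E injE).
by rewrite raddf0 (@tensor_map_comp _ _ _ _ _ n l k).
Qed.

End Acyclicity.

(** * Syzygies of a complex that defines PGF-modules *)

Section Complex.
Variables (R : pzRingType) (P : int -> lmodType R).
Variable d : forall n, {linear P (n + 1) -> P n}.
Hypothesis dproj : forall n, projective (P n).
Hypothesis dacyc : acyclic d.
Hypothesis dtensor : forall E : lmodType R^c, injective_module E ->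
  acyclic (fun n => tensor_map (d n) : tensor E _ -> tensor E _).

Lemma complex_dd n (x : P (n + 1 + 1)) : d n (d (n + 1) x) = 0.
Proof. by apply/dacyc; exists x. Qed.

(** Reading [D q] in degree [n] off degree [n + 1] of [q] avoids a transport between [P m] and
    [P (m - 1 + 1)]. *)
Lemma total_differential : exists D : {linear dsum P -> dsum P},
  (forall q n, dsum_val (D q) n = d n (q (n + 1))) /\
  (forall n (x : P (n + 1)), D (dsum_in x) = dsum_in (d n x)).
Proof.
have exD (q : dsum P) : exists y : dsum P, forall n, y n = d n (q (n + 1)).
  apply: (@dsum_build R _ P (fun n => d n (q (n + 1))) [seq n - 1 | n <- dsum_supp q]).
  move=> n nq; rewrite (@dsum_suppN _ _ _ q) ?linear0 //.
  by apply: contra nq => nq; apply/mapP; exists (n + 1); rewrite ?addrK.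
have [D DE] := choice exD.
have DL : linear D.
  by move=> a x y; apply: dsum_ext => n; rewrite [LHS]DE [RHS]/= !DE linearP.
exists (mklinear DL); split=> [q n|n x]; first exact: DE.
apply: dsum_ext => m; rewrite [LHS]DE.
have [<-|nm] := pselect (n = m); first by rewrite !dsum_in_same.
by rewrite !dsum_in_neq ?linear0 // => /addIr.
Qed.

Lemma total_tensor_exact (D : {linear dsum P -> dsum P}) (E : lmodType R^c) :
  (forall q n, dsum_val (D q) n = d n (q (n + 1))) ->
  (forall n (x : P (n + 1)), D (dsum_in x) = dsum_in (d n x)) ->
  injective_module E ->
  forall z : tensor E (dsum P), tensor_map D z = 0 -> exists w, tensor_map D w = z.
Proof.
move=> DE Din injE z Dz.
pose zc m := tensor_map (@dsum_proj R _ P m) z.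
have exy m : exists y, tensor_map (d m) y = zc m.
  (* Exactness is stated in degrees of the form [n + 1]. *)
  rewrite -[m](subrK 1); apply/(dtensor injE); rewrite /zc.
  rewrite (@tensor_map_comp _ _ _ _ _ _ _ (@dsum_proj R _ P (m - 1) \o D)); last first.
    by move=> q /=; rewrite /dsum_proj DE.
  by rewrite -(@tensor_map_comp _ _ _ _ _ D (@dsum_proj R _ P (m - 1))) // Dz raddf0.
have [s ->] := tensor_dsum_sum z.
exists (\sum_(m <- s) tensor_map (@dsum_in R _ P (m + 1)) (sval (cid (exy m)))).
rewrite raddf_sum; apply: eq_bigr => m _; case: cid => y yE /=.
rewrite -[tensor_map (@dsum_proj _ _ _ _) z]yE.
rewrite (@tensor_map_comp _ _ _ _ _ _ _ (@dsum_in R _ P m \o d m)); last first.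
  by move=> x; rewrite Din.
by rewrite -(@tensor_map_comp _ _ _ _ _ (d m) (@dsum_in R _ P m)).
Qed.

(** Extend [phi] by 0 to the other degrees, solve over the whole direct sum, and restrict the
    solution to degree [n]. *)
Lemma complex_ext_exact (F : lmodType R) n (phi : {linear P (n + 1) -> F}) :
  projective F -> (forall x, phi (d (n + 1) x) = 0) ->
  exists psi : {linear P n -> F}, forall x, psi (d n x) = phi x.
Proof.
move=> pF phi0; have [D [DE Din]] := total_differential.
have pP := dsum_projective dproj.
have local T : exists S, solvable_on D F T S.
  have [S gS] := solvable_on_regular T pP (fun E => @total_tensor_exact D E DE Din).
  by exists S; apply: solvable_on_projective.
have [supp [L [L1 L2]]] := dual_basis F pP.
have DD q : D (D q) = 0.
  by apply: dsum_ext => m; rewrite DE DE complex_dd.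
have [q|psi psiE] := @global_solvability _ _ F D DD local supp L L1 L2
  (phi \o @dsum_proj R _ P (n + 1)).
  by rewrite /= /dsum_proj DE phi0.
exists (psi \o @dsum_in R _ P n) => x.
by rewrite /= -Din psiE; apply: (congr1 phi (dsum_in_same x)).
Qed.

(** The module [K'] is the image of the next differential. For Tor, lift [z] along this surjection
    to a cycle, hence a boundary, whose image in [K'] is 0. For Ext, a map on [K'] becomes a
    cocycle, and a solution of its equation is the extension sought. *)
Lemma complex_kernel_acyclic n (K K' : lmodType R) (f : {linear K -> P (n + 1)})
    (f' : {linear K' -> P (n + 1 + 1)}) :
  is_kernel f (d n) -> is_kernel f' (d (n + 1)) ->
  exists p : {linear P (n + 1 + 1) -> K},
    [/\ ses f' p, tor_acyclic K & ext_acyclic K].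
Proof.
move=> [fi fex] [f'i f'ex].
have [|p pE] := @factor_inj _ _ _ _ f (d (n + 1)) fi.
  by move=> x; apply/fex/complex_dd.
have f'p : ses f' p.
  split=> // [x|k]; last first.
    have /dacyc[x xE] : d n (f k) = 0 by apply/fex; exists k.
    by exists x; apply: fi; rewrite pE.
  rewrite -f'ex -pE; split=> [->|px]; first exact: linear0.
  by apply: fi; rewrite px linear0.
exists p; split=> //.
  apply: (tor_acyclicI (@dproj _) f'p) => E injE; apply: tensor_map_inj => z f'z.
  have [|q qE] := @factor_inj _ _ _ _ f' (d (n + 1 + 1)) f'i.
    by move=> x; apply/f'ex/complex_dd.
  have sq : surj q.
    move=> k; have /dacyc[x xE] : d (n + 1) (f' k) = 0 by apply/f'ex; exists k.
    by exists x; apply: f'i; rewrite qE.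
  have [w wz] := tensor_map_surj sq z.
  have /(dtensor injE)[v vw] : tensor_map (d (n + 1 + 1)) w = 0.
    by rewrite -f'z -wz (tensor_map_comp qE).
  rewrite -wz -vw (@tensor_map_comp _ _ _ _ _ _ _ (q \o d (n + 1 + 1 + 1))) //.
  apply: tensor_map0 => x; apply: f'i.
  by rewrite linear0 /= qE complex_dd.
apply: (ext_acyclicI (@dproj _) f'p) => F g pF.
have [|q qE] := @factor_inj _ _ _ _ f' (d (n + 1 + 1)) f'i.
  by move=> x; apply/f'ex/complex_dd.
have sq : surj q.
  move=> k; have /dacyc[x xE] : d (n + 1) (f' k) = 0 by apply/f'ex; exists k.
  by exists x; apply: f'i; rewrite qE.
have [x|psi psiE] := @complex_ext_exact F (n + 1 + 1 : int) (g \o q) pF.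
  rewrite /=; have -> : q (d (n + 1 + 1 + 1) x) = 0; last exact: linear0.
  by apply: f'i; rewrite linear0 qE complex_dd.
by exists psi => c; have [x <-] := sq c; rewrite qE psiE.
Qed.

End Complex.

(** * PGF-modules as a largest class *)

Section PGFTheory.
Variable R : pzRingType.
Implicit Types A B C K Q X M N F : lmodType R.

Lemma PGF_acyclic M : PGF M ->
  [/\ tor_acyclic M, ext_acyclic M,
      exists Q M' (i : {linear M -> Q}) (p : {linear Q -> M'}),
        [/\ projective Q, PGF M' & ses i p] &
      exists Q M' (i : {linear M' -> Q}) (p : {linear Q -> M}),
        [/\ projective Q, PGF M' & ses i p]].
Proof.
move=> [P [d [dproj dacyc dtensor [n0 [f0]]]]].
(* With [n0 = m + 1] the differential [d m] is available; its kernel is the syzygy to the right of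
   [M]. *)
have [m mE] : exists m, n0 = m + 1 by exists (n0 - 1); rewrite subrK.
move: f0; rewrite {n0}mE => f fker.
have PGFker n K (i : {linear K -> P (n + 1)}) : is_kernel i (d n) -> PGF K.
  by move=> ?; exists P, d; split=> //; exists n, i.
have [K [k kker]] := kernel_lmod (d (m + 1 + 1)).
have [p [fp torM extM]] := complex_kernel_acyclic dproj dacyc dtensor fker kker.
have [M' [i iker]] := kernel_lmod (d m).
have [q [iq _ _]] := complex_kernel_acyclic dproj dacyc dtensor iker fker.
split=> //.
  by exists (P (m + 1 + 1)), M', f, q; split=> //; apply: PGFker iker.
by exists (P (m + 1 + 1 + 1)), K, k, p; split=> //; apply: PGFker kker.
Qed.

(* The projective terms and the differentials are chosen only after the syzygies are
   indexed by int, so that no transport along n + 1 is needed. *)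
Lemma PGF_coind (Cl : lmodType R -> Prop) :
  (forall X, Cl X -> tor_acyclic X) ->
  (forall X, Cl X -> exists Q X' (i : {linear X -> Q}) (p : {linear Q -> X'}),
     [/\ projective Q, Cl X' & ses i p]) ->
  (forall X, Cl X -> exists Q X' (i : {linear X' -> Q}) (p : {linear Q -> X}),
     [/\ projective Q, Cl X' & ses i p]) ->
  forall X, Cl X -> PGF X.
Proof.
move=> tor right left X0 CX0.
pose step A B := exists Q (i : {linear A -> Q}) (p : {linear Q -> B}),
  projective Q /\ ses i p.
pose T := {X | Cl X}.
have rightT (X : T) : exists Y : T, step (sval X) (sval Y).
  case: X => X CX; have [Q [Y [i [p [pQ CY ip]]]]] := right X CX.
  by exists (exist _ Y CY), Q, i, p.
have leftT (X : T) : exists Y : T, step (sval Y) (sval X).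
  case: X => X CX; have [Q [Y [i [p [pQ CY ip]]]]] := left X CX.
  by exists (exist _ Y CY), Q, i, p.
have [up upE] := choice leftT; have [down downE] := choice rightT.
pose X1 : T := exist _ X0 CX0.
(* [Negz n] is -(n + 1), whence the [n.+1] steps to the right. *)
pose x (n : int) : T :=
  match n with Posz n => iter n up X1 | Negz n => iter n.+1 down X1 end.
have xstep n : step (sval (x (n + 1))) (sval (x n)).
  case: n => n; first by rewrite -PoszD addn1; apply: upE.
  have -> : Negz n + 1 = - n%:Z by rewrite NegzE -addn1 PoszD opprD subrK.
  by case: n => [|n]; [apply: downE|rewrite -NegzE; apply: downE].
have [P PE] := choice xstep.
pose Y n := sval (x n).
pose i n : {linear Y (n + 1) -> P n} := sval (cid (PE n)).
have ipE n : exists p : {linear P n -> Y n}, projective (P n) /\ ses (i n) p.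
  by rewrite /i; case: cid.
pose p n : {linear P n -> Y n} := sval (cid (ipE n)).
have pP n : projective (P n) by case: (ipE n) => ? [].
have ip n : ses (i n) (p n) by rewrite /p; case: cid => ? [].
have torY n : tor_acyclic (Y n) by apply: tor; apply: svalP.
pose d n : {linear P (n + 1) -> P n} := i n \o p (n + 1).
have dker n : is_kernel (i (n + 1)) (d n).
  have [ii ex _] := ip (n + 1); have [in_inj _ _] := ip n; split=> // b.
  rewrite -ex /=; split=> [ipb|->]; last exact: linear0.
  by apply: in_inj; rewrite ipb linear0.
have YP m : exists n (f : {linear Y m -> P (n + 1)}), is_kernel f (d n).
  (* [Y m] embeds in degree [m - 1], as the kernel of the differential into degree [m - 2]. *)
  by rewrite -[m](subrK 1) -[m - 1](subrK 1); exists (m - 1 - 1), (i (m - 1 - 1 + 1)).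
exists P, d; split=> //; last exact: (YP 0).
  move=> n b; have [_ ex] := dker n; rewrite (ex b).
  have [_ _ sp] := ip (n + 1 + 1).
  split=> [[c <-]|[a <-]]; last by exists (p (n + 1 + 1) a).
  by have [a <-] := sp c; exists a.
(* As [Y n] is Tor-acyclic, [i n] stays injective after tensoring; right exactness of the tensor
   product then gives the boundary. *)
move=> E injE n b; have [_ ex sp] := ip (n + 1).
have [_ _ sp'] := ip (n + 1 + 1).
have dE m z :
    tensor_map (d m) z = tensor_map (i m) (tensor_map (p (m + 1)) z) :> tensor E _.
  by rewrite (@tensor_map_comp _ _ _ _ _ _ _ (d m)).
split=> [db|[a <-]].
  have pb : tensor_map (p (n + 1)) b = 0.
    by apply: (torY n _ _ _ _ (ip n) E injE); rewrite -dE db raddf0.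
  have [c <-] := tensor_right_exact ex sp pb.
  have [a <-] := tensor_map_surj sp' c.
  by exists a; rewrite dE.
rewrite !dE (@tensor_map_comp _ _ _ _ _ (i (n + 1)) (p (n + 1))
  (p (n + 1) \o i (n + 1))) //.
rewrite [X in tensor_map _ X]tensor_map0 ?raddf0 // => y.
exact: (ses_comp _ (ip (n + 1))).
Qed.

End PGFTheory.

(** * Closure properties of PGF and syzygies *)

Section Closure.
Variable R : pzRingType.
Implicit Types A B C D K L G Q QA QC X Y M N F : lmodType R.

(** The horseshoe lemma: projectivity of [QC] lifts [c] to B, and the kernel of the joint cover is
    an extension of [C1] by [A1]. *)
Lemma horseshoe_left A B C A1 QA C1 QC
    (i : {linear A -> B}) (p : {linear B -> C})
    (a1 : {linear A1 -> QA}) (a : {linear QA -> A})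
    (c1 : {linear C1 -> QC}) (c : {linear QC -> C}) :
  projective QC -> ses i p -> ses a1 a -> ses c1 c ->
  exists (K : lmodType R) (k : {linear K -> (QA * QC)%type})
    (v : {linear (QA * QC)%type -> B})
    (f : {linear A1 -> K}) (g : {linear K -> C1}), ses k v /\ ses f g.
Proof.
move=> pQC ip a1a c1c.
have [ii ex sp] := ip; have [ia1 exa sa] := a1a; have [ic1 exc sc] := c1c.
have [h hE] := pQC _ _ p c sp.
have vL : linear (fun z : (QA * QC)%type => i (a z.1) + h z.2).
  by move=> t x y; rewrite !linearP /= scalerDr addrACA.
have sv : surj (mklinear vL).
  move=> b; have [y yE] := sc (p b).
  have /ex[x xE] : p (b - h y) = 0 by rewrite linearB hE yE subrr.
  by have [z zE] := sa x; exists (z, y); rewrite /= zE xE subrK.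
have [K [k kv]] := ses_kernel sv; have [ik ek _] := kv.
have [|f fE] := @factor_inj _ _ _ _ k (pairl QA QC \o a1) ik.
  by move=> x; apply/ek; rewrite /= (ses_comp _ a1a) !linear0 addr0.
have [|g gE] := @factor_inj _ _ _ _ c1 (@snd QA QC \o k) ic1.
  move=> x; apply/exc => /=; rewrite -hE.
  have /(congr1 p) := ses_comp x kv.
  by rewrite /= linearD (ses_comp _ ip) add0r linear0.
exists K, k, (mklinear vL), f, g; split=> //; split.
- by move=> x y /(congr1 k); rewrite !fE => -[/ia1].
- move=> z; split=> [gz|[x <-]]; last by apply: ic1; rewrite gE /= fE linear0.
  have kz2 : (k z).2 = 0 by have := gE z; rewrite gz linear0.
  have /exa[x xE] : a (k z).1 = 0.
    apply: ii; have := ses_comp z kv.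
    by rewrite /= kz2 !linear0 addr0.
  exists x; apply: ik; rewrite fE /= xE.
  by apply: injective_projections; rewrite /= ?kz2.
- move=> y; have /ex[x xE] : p (h (c1 y)) = 0 by rewrite hE (ses_comp _ c1c).
  have [z zE] := sa x.
  have /ek[w wE] : mklinear vL (- z, c1 y) = 0.
    by rewrite /= !linearN zE xE addNr.
  by exists w; apply: ic1; rewrite gE /= wE.
Qed.

(** The dual horseshoe. Since [QA] need not be injective, the extension [u] of [a] to B is an
    assumption. *)
Lemma horseshoe_right A B C A' QA C' QC
    (i : {linear A -> B}) (p : {linear B -> C})
    (a : {linear A -> QA}) (a' : {linear QA -> A'})
    (c : {linear C -> QC}) (c' : {linear QC -> C'}) (u : {linear B -> QA}) :
  ses i p -> ses a a' -> ses c c' -> (forall x, u (i x) = a x) ->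
  exists (D : lmodType R) (w : {linear B -> (QA * QC)%type})
    (q : {linear (QA * QC)%type -> D})
    (f : {linear A' -> D}) (g : {linear D -> C'}), ses w q /\ ses f g.
Proof.
move=> ip aa cc uE.
have [ii ex sp] := ip; have [ia exa sa] := aa; have [ic exc sc] := cc.
have wL : linear (fun b => (u b, c (p b))).
  by move=> t x y; apply: injective_projections; rewrite /= !linearP.
have w0 b : u b = 0 -> c (p b) = 0 -> b = 0.
  move=> ub cb; have /ex[x xE] : p b = 0 by apply: ic; rewrite cb linear0.
  by rewrite -xE (_ : x = 0) ?linear0 //; apply: ia; rewrite -uE xE ub linear0.
have wi : injective (mklinear wL) by apply: linear_inj => b [/w0]; apply.
have [D [q wq]] := ses_cokernel wi; have [_ eq sq] := wq.
have [|f fE] := @factor_surj _ _ _ _ a' (q \o pairl QA QC) sa.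
  move=> _ /exa[y <-]; apply/eq; exists (i y).
  by rewrite /= uE (ses_comp _ ip) linear0.
have [|g gE] := @factor_surj _ _ _ _ q (c' \o @snd QA QC) sq.
  by move=> _ /eq[b <-]; rewrite /= (ses_comp _ cc).
exists D, (mklinear wL), q, f, g; split=> //; split.
- apply: linear_inj => y; have [x <-] := sa y.
  rewrite fE => /eq[b [ub cb]].
  have /ex[z zE] : p b = 0 by apply: ic; rewrite cb linear0.
  by rewrite -ub -zE uE (ses_comp _ aa).
- move=> d; split=> [gd|[y <-]].
    have [[x y] xyE] := sq d.
    have /exc[z zE] : c' y = 0 by rewrite -gd -xyE gE.
    have [b bE] := sp z; exists (a' (x - u b)); rewrite fE -xyE /=.
    apply/eqP; rewrite -subr_eq0 -linearB; apply/eqP/eq; exists (- b).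
    apply: injective_projections; rewrite /= ?linearN.
      by rewrite addrAC subrr add0r.
    by rewrite bE zE sub0r.
  by have [x <-] := sa y; rewrite fE gE /= linear0.
- by move=> y; have [x <-] := sc y; exists (q (0, x)); rewrite gE.
Qed.

Lemma PGF_ext A B C (i : {linear A -> B}) (p : {linear B -> C}) :
  ses i p -> PGF A -> PGF C -> PGF B.
Proof.
move=> ip pA pC.
apply: (@PGF_coind R (fun B => exists A C (i : {linear A -> B}) (p : {linear B -> C}),
  [/\ ses i p, PGF A & PGF C])); last by exists A, C, i, p.
- move=> {A B C i p ip pA pC} B [A [C [i [p [ip pA pC]]]]].
  have [tA _ _ _] := PGF_acyclic pA; have [tC _ _ _] := PGF_acyclic pC.
  exact: tor_acyclic_ext ip tA tC.
- move=> {A B C i p ip pA pC} B [A [C [i [p [ip pA pC]]]]].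
  have [_ _ [QA [A' [a [a' [pQA pA' aa]]]]] _] := PGF_acyclic pA.
  have [_ eC [QC [C' [c [c' [pQC pC' cc]]]]] _] := PGF_acyclic pC.
  (* Ext^1(C, QA) = 0 provides the extension for the right horseshoe. *)
  have [u uE] := eC _ _ _ _ _ pQA ip a.
  have [D [w [q [f [g [wq fg]]]]]] := horseshoe_right ip aa cc uE.
  exists (QA * QC)%type, D, w, q; split=> //; first exact: projective_prod.
  by exists A', C', f, g.
- move=> {A B C i p ip pA pC} B [A [C [i [p [ip pA pC]]]]].
  have [_ _ _ [QA [A' [a [a' [pQA pA' aa]]]]]] := PGF_acyclic pA.
  have [_ _ _ [QC [C' [c [c' [pQC pC' cc]]]]]] := PGF_acyclic pC.
  have [K [k [v [f [g [kv fg]]]]]] := horseshoe_left pQC ip aa cc.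
  exists (QA * QC)%type, K, k, v; split=> //; first exact: projective_prod.
  by exists A', C', f, g.
Qed.

Lemma ses_prod A B : ses (pairl A B) (@snd A B).
Proof.
split=> [x y []//|[x y]|y]; last by exists (0, y).
by split=> [/= ->|[z <-]//]; exists x.
Qed.

Lemma trivial_projective X : (forall x : X, x = 0) -> projective X.
Proof. by move=> X0 A B g f _; exists \0 => x; rewrite (X0 x) !linear0. Qed.

Lemma projective_tor_acyclic X : projective X -> tor_acyclic X.
Proof.
move=> pX A B i p ip E _; have [ii ex sp] := ip.
have [h hE] := pX _ _ p idfun sp.
have [|r rE] := @factor_inj _ _ _ _ i (idfun \- (h \o p)) ii.
  by move=> b; apply/ex; rewrite /= linearB hE subrr.
have ri a : r (i a) = a by apply: ii; rewrite rE /= (ses_comp _ ip) linear0 subr0.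
move=> x y /(congr1 (tensor_map r)).
by rewrite !(@tensor_map_comp _ _ _ _ _ i r (r \o i)) // !tensor_map_id.
Qed.

(** The identity of [X] with a zero third term serves on both sides, and the zero module is
    projective. *)
Lemma projective_PGF X : projective X -> PGF X.
Proof.
apply: PGF_coind => {}X pX; first exact: projective_tor_acyclic.
  have [C [q iq]] := @ses_cokernel R X X idfun (fun _ _ => id).
  have [_ ex sq] := iq.
  exists X, C, idfun, q; split=> //; apply: trivial_projective => c.
  by have [x <-] := sq c; apply/ex; exists x.
have [K [k kq]] := @ses_kernel R X X idfun (fun x => ex_intro _ x erefl).
have [ik _ _] := kq.
exists X, K, k, idfun; split=> //; apply: trivial_projective => x.
by apply: ik; rewrite linear0; have := ses_comp x kq.
Qed.

(* With f : Q -> Q lifting s \o r : M -> M, the maps x |-> (f x, x) and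
   (m, y) |-> k m + (y - f y) exhibit K' as a retract of K * Q. *)
Lemma ses_retract_kernel K Q M X (k : {linear K -> Q}) (q : {linear Q -> M}) :
  projective Q -> ses k q -> retract_of X M ->
  exists K' (k' : {linear K' -> Q}) (q' : {linear Q -> X}),
    ses k' q' /\ retract_of K' (K * Q)%type.
Proof.
move=> pQ kq [s [r rs]]; have [ik ek sq] := kq.
have srq : surj (r \o q).
  by move=> x; have [y yE] := sq (s x); exists y; rewrite /= yE rs.
have [K' [k' k'q']] := ses_kernel srq; have [ik' ek' _] := k'q'.
have [f fE] := pQ _ _ q (s \o r \o q) sq.
have [|S SE] := @factor_inj _ _ _ _ k (f \o k') ik.
  by move=> x; apply/ek; rewrite /= fE; have /= -> := ses_comp x k'q'; rewrite linear0.
have [|T TE] := @factor_inj _ _ _ _ k'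
  ((k \o @fst K Q) \+ (@snd K Q \- (f \o @snd K Q))) ik'.
  move=> z; apply/ek'; rewrite /= !(linearD, linearN) (ses_comp _ kq) linear0 add0r.
  by rewrite fE /= rs subrr.
have SL : linear (fun x => (S x, k' x)).
  by move=> a x y; apply: injective_projections; rewrite /= linearP.
exists K', k', (r \o q); split=> //; exists (mklinear SL), T => x.
by apply: ik'; rewrite TE /= SE /= addrC subrK.
Qed.

(* Dually, f : Q -> Q extends s \o r, and D is a retract of M' * Q via
   [x] |-> (j' x, x - f x) and (j' x, y) |-> [f x + y]. *)
Lemma ses_retract_cokernel M Q M' X (j : {linear M -> Q}) (j' : {linear Q -> M'}) :
  projective Q -> ses j j' -> ext_acyclic M' -> retract_of X M ->
  exists (D : lmodType R) (i : {linear X -> Q}) (q : {linear Q -> D}),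
    ses i q /\ retract_of D (M' * Q)%type.
Proof.
move=> pQ jj eM' [s [r rs]]; have [ij ej sj'] := jj.
have is_ : injective (j \o s).
  by move=> x y /= /ij /(congr1 r); rewrite !rs.
have [D [q iq]] := ses_cokernel is_; have [_ eq sq] := iq.
have [f fE] := eM' _ _ _ _ _ pQ jj (j \o s \o r).
pose f' : {linear Q -> Q} := idfun \- f.
have SL : linear (fun x => (j' x, f' x)).
  move=> a x y.
  by apply: injective_projections; [exact: (linearP j')|exact: (linearP f')].
have [|S SE] := @factor_surj _ _ _ _ q (mklinear SL) sq.
  by move=> _ /eq[x <-]; rewrite /= fE /= rs subrr (ses_comp _ jj).
have [|T TE] := @factor_surj _ _ _ _ j' (q \o f) sj'.
  by move=> _ /ej[m <-]; apply/eq; exists (r m); rewrite fE.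
have VL : linear (fun z : (M' * Q)%type => T z.1 + q z.2).
  by move=> a x y; rewrite !linearP /= scalerDr addrACA.
exists D, (j \o s), q; split=> //; exists S, (mklinear VL) => d.
by have [x <-] := sq d; rewrite SE /= TE /= -linearD addrC subrK.
Qed.

(** Retracts of PGF-modules form a class as in [PGF_coind]: on either side the third term is a
    retract of [(M' * Q)%type], an extension of PGF-modules. *)
Lemma PGF_retract X M : retract_of X M -> PGF M -> PGF X.
Proof.
move=> XM pM.
apply: (@PGF_coind R (fun X => exists M, PGF M /\ retract_of X M)); last by exists M.
- move=> {X M XM pM} X [M [pM XM]].
  by have [tM _ _ _] := PGF_acyclic pM; apply: tor_acyclic_retract tM.
- move=> {X M XM pM} X [M [pM XM]].
  have [_ _ [Q [M' [i [p [pQ pM' ip]]]]] _] := PGF_acyclic pM.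
  have [_ eM' _ _] := PGF_acyclic pM'.
  have [D [i' [q [iq DM]]]] := ses_retract_cokernel pQ ip eM' XM.
  exists Q, D, i', q; split=> //; exists (M' * Q)%type; split=> //.
  exact: PGF_ext (ses_prod _ _) pM' (projective_PGF pQ).
- move=> {X M XM pM} X [M [pM XM]].
  have [_ _ _ [Q [M' [i [p [pQ pM' ip]]]]]] := PGF_acyclic pM.
  have [K' [k' [q' [kq K'M]]]] := ses_retract_kernel pQ ip XM.
  exists Q, K', k', q'; split=> //; exists (M' * Q)%type; split=> //.
  exact: PGF_ext (ses_prod _ _) pM' (projective_PGF pQ).
Qed.

Section DsumClosure.
Variable I : choiceType.

Lemma step_choice (Cl : lmodType R -> Prop) (M : I -> lmodType R) :
  (forall j, exists Q N (i : {linear N -> Q}) (p : {linear Q -> M j}),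
     [/\ projective Q, Cl N & ses i p]) ->
  exists (Q N : I -> lmodType R) (i : forall j, {linear N j -> Q j})
    (p : forall j, {linear Q j -> M j}),
    forall j, [/\ projective (Q j), Cl (N j) & ses (i j) (p j)].
Proof.
move=> /choice[Q] /choice[N] H.
pose i j := sval (cid (H j)); exists Q, N, i.
have H' j : exists p : {linear Q j -> M j},
    [/\ projective (Q j), Cl (N j) & ses (i j) p].
  by rewrite /i; case: cid.
by exists (fun j => sval (cid (H' j))) => j; case: cid.
Qed.

Lemma costep_choice (Cl : lmodType R -> Prop) (M : I -> lmodType R) :
  (forall j, exists Q N (i : {linear M j -> Q}) (p : {linear Q -> N}),
     [/\ projective Q, Cl N & ses i p]) ->
  exists (Q N : I -> lmodType R) (i : forall j, {linear M j -> Q j})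
    (p : forall j, {linear Q j -> N j}),
    forall j, [/\ projective (Q j), Cl (N j) & ses (i j) (p j)].
Proof.
move=> /choice[Q] /choice[N] H.
pose i j := sval (cid (H j)); exists Q, N, i.
have H' j : exists p : {linear Q j -> N j},
    [/\ projective (Q j), Cl (N j) & ses (i j) p].
  by rewrite /i; case: cid.
by exists (fun j => sval (cid (H' j))) => j; case: cid.
Qed.

Lemma dsum_PGF (M : I -> lmodType R) : (forall j, PGF (M j)) -> PGF (dsum M).
Proof.
move=> pM; apply: (@PGF_coind R (fun X => exists M : I -> lmodType R,
  (forall j, PGF (M j)) /\ X = dsum M)); last by exists M.
- move=> _ [{pM}{}M [pM ->]].
  have left j : exists Q N (i : {linear N -> Q}) (p : {linear Q -> M j}),
     [/\ projective Q, PGF N & ses i p] by have [_ _ _] := PGF_acyclic (pM j).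
  have [Q [N [i [p H]]]] := step_choice left.
  have ip j : ses (i j) (p j) by have [] := H j.
  apply: (@tor_acyclicI _ _ _ _ _ _ _ (dsum_ses ip)).
    by apply: dsum_projective => j; have [] := H j.
  (* Components detect zero, so Tor-acyclicity of each [M j] applies. *)
  move=> E injE; apply: tensor_map_inj => z iz; apply: tensor_dsum_eq0 => j.
  have [tM _ _ _] := PGF_acyclic (pM j).
  apply: (tM _ _ _ _ (ip j) E injE); rewrite raddf0.
  rewrite (@tensor_map_comp _ _ _ _ _ _ _ (@dsum_proj R I Q j \o dsum_map i)) //.
  by rewrite -(@tensor_map_comp _ _ _ _ _ (dsum_map i) (@dsum_proj R I Q j)) //
    iz raddf0.
- move=> _ [{pM}{}M [pM ->]].
  have right j : exists Q N (i : {linear M j -> Q}) (p : {linear Q -> N}),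
     [/\ projective Q, PGF N & ses i p] by have [_ _ ] := PGF_acyclic (pM j).
  have [Q [N [i [p H]]]] := costep_choice right.
  exists (dsum Q), (dsum N), (dsum_map i), (dsum_map p); split.
  + by apply: dsum_projective => j; have [] := H j.
  + by exists N; split=> // j; have [] := H j.
  + by apply: dsum_ses => j; have [] := H j.
- move=> _ [{pM}{}M [pM ->]].
  have left j : exists Q N (i : {linear N -> Q}) (p : {linear Q -> M j}),
     [/\ projective Q, PGF N & ses i p] by have [_ _ _] := PGF_acyclic (pM j).
  have [Q [N [i [p H]]]] := step_choice left.
  exists (dsum Q), (dsum N), (dsum_map i), (dsum_map p); split.
  + by apply: dsum_projective => j; have [] := H j.
  + by exists N; split=> // j; have [] := H j.
  + by apply: dsum_ses => j; have [] := H j.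
Qed.

End DsumClosure.

(** Projective terms, unlike the PGF terms of a resolution, allow lifting, so the horseshoe and
    retract arguments apply at every stage. *)
Fixpoint syzygy_PGF n M : Prop :=
  if n is n'.+1 then exists Q K (i : {linear K -> Q}) (p : {linear Q -> M}),
    [/\ projective Q, syzygy_PGF n' K & ses i p]
  else PGF M.

Lemma syzygy_PGF_ext n A B C (i : {linear A -> B}) (p : {linear B -> C}) :
  ses i p -> PGF A -> syzygy_PGF n C -> syzygy_PGF n B.
Proof.
elim: n A B C i p => [|n IH] A B C i p ip pA; first exact: PGF_ext ip pA.
move=> [QC [C1 [c1 [c [pQC pC1 cc]]]]].
have [_ _ _ [QA [A1 [a1 [a [pQA pA1 aa]]]]]] := PGF_acyclic pA.
have [K [k [v [f [g [kv fg]]]]]] := horseshoe_left pQC ip aa cc.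
exists (QA * QC)%type, K, k, v; split=> //; first exact: projective_prod.
exact: IH fg pA1 pC1.
Qed.

Lemma syzygy_PGFS n M : syzygy_PGF n M -> syzygy_PGF n.+1 M.
Proof.
elim: n M => [|n IH] M; first by case/PGF_acyclic => _ _ _; exact.
move=> [Q [K [i [p [pQ pK ip]]]]].
by exists Q, K, i, p; split=> //; apply: IH.
Qed.

Lemma syzygy_PGF_mono m n M : (m <= n)%N -> syzygy_PGF m M -> syzygy_PGF n M.
Proof.
elim: n => [|n IH]; first by rewrite leqn0 => /eqP ->.
by rewrite leq_eqVlt => /predU1P[->//|/IH mn /mn]; apply: syzygy_PGFS.
Qed.

Lemma syzygy_PGF_retract n X M :
  retract_of X M -> syzygy_PGF n M -> syzygy_PGF n X.
Proof.
elim: n X M => [|n IH] X M XM; first exact: PGF_retract XM.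
move=> [Q [K [i [p [pQ pK ip]]]]].
have [K' [k' [q' [kq K'K]]]] := ses_retract_kernel pQ ip XM.
exists Q, K', k', q'; split=> //; apply: (IH _ _ K'K).
(* The product is viewed with [Q] as submodule and [K] as quotient, because in [syzygy_PGF_ext] the
   submodule is PGF and the quotient has the n-th syzygy. *)
have QKL : linear (fun y : Q => (0 : K, y)).
  by move=> a x y; apply: injective_projections; rewrite /= ?scaler0 ?addr0.
apply: (@syzygy_PGF_ext n Q _ K (mklinear QKL) (@fst K Q)) => //.
  split=> [x y []//|[x y]|x]; last by exists (x, 0).
  by split=> [/= ->|[z <-]//]; exists y.
exact: projective_PGF.
Qed.

Lemma syzygy_PGF_dsum (I : choiceType) n (M : I -> lmodType R) :
  (forall j, syzygy_PGF n (M j)) -> syzygy_PGF n (dsum M).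
Proof.
elim: n M => [|n IH] M pM; first exact: dsum_PGF.
have [Q [N [i [p H]]]] := step_choice pM.
exists (dsum Q), (dsum N), (dsum_map i), (dsum_map p); split.
- by apply: dsum_projective => j; have [] := H j.
- by apply: IH => j; have [] := H j.
- by apply: dsum_ses => j; have [] := H j.
Qed.

(** Covering [G] by a projective [Q] with PGF kernel [G1], the preimage of [K] in [Q] is a first
    syzygy of [M] and an extension of [K] by [G1]. *)
Lemma syzygy_PGF_cokernel n K G M (k : {linear K -> G}) (p : {linear G -> M}) :
  ses k p -> PGF G -> syzygy_PGF n K -> syzygy_PGF n.+1 M.
Proof.
move=> kp pG pK.
have [_ _ _ [Q [G1 [g1 [g [pQ pG1 gg]]]]]] := PGF_acyclic pG.
have [L [l [n' [m [lq nm nE]]]]] := ses_preimage kp gg.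
by exists Q, L, l, (p \o g); split=> //; apply: syzygy_PGF_ext nm pG1 pK.
Qed.

Lemma syzygy_PGF_resolution n M : syzygy_PGF n M -> PGF_resolution M n.
Proof.
elim: n M => [|n IH] M.
  (* The empty direct sum is the zero module in positive degrees. *)
  move=> pM; pose Z : lmodType R := dsum (fun _ : void => R^o : lmodType R).
  have Z0 (z : Z) : z = 0 by apply: dsum_ext.
  pose G k : lmodType R := if k is _.+1 then Z else M.
  pose d k : {linear G k.+1 -> G k} := \0.
  exists G, d, idfun; split=> [[]//|[]//|m|m|k z]; first by exists m.
    by split=> [/= ->|[_ <-]//]; exists 0.
  by split=> _ //; exists 0; rewrite [RHS]Z0.
move=> [Q [K [i [p [pQ pK ip]]]]]; have [ii ex sp] := ip.
have [G [d [e [pG G0 se exe exd]]]] := IH K pK.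
pose G' k : lmodType R := if k is k'.+1 then G k' else Q.
pose d' k : {linear G' k.+1 -> G' k} :=
  if k is k'.+1 then d k' else i \o e.
exists G', d', p; split=> //.
- by case=> [|k] //; [move=> _; apply: projective_PGF|apply: pG].
- by case=> [|k] //; apply: G0.
- move=> b; rewrite (ex b); split=> [[a <-]|[x <-]]; last by exists (e x).
  by have [x <-] := se a; exists x.
- case=> [|k] x; last exact: exd.
  rewrite -(exe x) /=; split=> [ix|->]; last exact: linear0.
  by apply: ii; rewrite ix linear0.
Qed.

Lemma PGF_resolutionP n M : PGF_resolution M n <-> syzygy_PGF n M.
Proof.
split; last exact: syzygy_PGF_resolution.
elim: n M => [|n IH] M [G [d [e [pG G0 se exe exd]]]].
  (* In length 0 the term [G 1] is zero, so [e] is an isomorphism. *)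
  have ei : injective e.
    apply: linear_inj => x /exe[y <-]; rewrite (G0 1%N _ y) ?linear0 //.
  have [|s sE] := @factor_surj _ _ _ _ e idfun se.
    by move=> x; rewrite -(linear0 e) => /ei.
  apply: PGF_retract (pG 0%N isT); exists s, e => m.
  by have [x <-] := se m; rewrite sE.
have [K [k ke]] := ses_kernel se; have [ki ek _] := ke.
apply: (syzygy_PGF_cokernel ke (pG 0%N isT)); apply: IH.
(* [d 0], corestricted to the kernel of [e], augments the shifted resolution. *)
have [|e' e'E] := @factor_inj _ _ _ _ k (d 0%N) ki.
  by move=> x; apply/ek/exe; exists x.
exists (fun j => G j.+1), (fun j => d j.+1), e'; split=> //.
- by move=> j jn; apply: pG.
- by move=> j nj; apply: G0.
- move=> x; have /exe[y yE] : e (k x) = 0 by apply: ses_comp ke.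
  by exists y; apply: ki; rewrite e'E.
- move=> x; rewrite -(exd 0%N x) -e'E.
  by split=> [->|kx]; [apply: linear0|apply: ki; rewrite kx linear0].
Qed.

Lemma PGF_dim_le n M : le_enat (PGF_dim M) (Fin n) <-> syzygy_PGF n M.
Proof.
rewrite -PGF_resolutionP; apply: le_least => p q pq.
by rewrite !PGF_resolutionP; apply: syzygy_PGF_mono.
Qed.

Lemma finite_PGF_dimP M : finite_PGF_dim M <-> exists n, syzygy_PGF n M.
Proof.
split=> [|[n /PGF_dim_le]]; rewrite /finite_PGF_dim.
  case E : (PGF_dim M) => [n|] // _; exists n; apply/PGF_dim_le.
  by rewrite E /=.
by case: (PGF_dim M).
Qed.

End Closure.

(** * PGF-dimension of direct sums and direct summands *)

Lemma syzygy_PGF_dsumE (R : pzRingType) (I : Type) (M : I -> lmodType R) n :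
  syzygy_PGF n (dsum M) <-> forall i, syzygy_PGF n (M i).
Proof.
(* [{classic I}] equips the arbitrary type [I] with a choice structure. *)
split=> [pM i|]; last exact: (@syzygy_PGF_dsum R {classic I} n M).
exact: (syzygy_PGF_retract (@dsum_in_retract R {classic I} M i)).
Qed.

Theorem proposition2p3 (R : pzRingType) :
  [/\ forall (I : Type) (M : I -> lmodType R),
        PGF_dim (dsum M) = enat_sup (fun i => PGF_dim (M i)),
      forall (I : finType) (M : I -> lmodType R),
        (forall i, finite_PGF_dim (M i)) -> finite_PGF_dim (dsum M) &
      forall M N : lmodType R,
        direct_summand N M -> finite_PGF_dim M -> finite_PGF_dim N].
Proof.
split=> [I M|I M fM|M N [N' [f [g fK gK]]] /finite_PGF_dimP[n pM]].
(* Both sides are [least] of a predicate on natural numbers; equality of the predicates covers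
   infinite values as well. *)
- congr least; apply/funext => n; apply/propext.
  rewrite PGF_resolutionP syzygy_PGF_dsumE.
  by split=> h i; apply/PGF_dim_le.
- have /choice[n pM] i : exists n, syzygy_PGF n (M i) by apply/finite_PGF_dimP.
  apply/finite_PGF_dimP; exists (\max_i n i); apply/syzygy_PGF_dsumE => i.
  by apply: syzygy_PGF_mono (pM i); apply: leq_bigmax.
- apply/finite_PGF_dimP; exists n; apply: syzygy_PGF_retract pM.
  have gL : linear g.
    by move=> a x y; apply: (can_inj fK); rewrite gK linearP !gK.
  by exists (f \o pairl N N'), (@fst N N' \o mklinear gL) => x /=; rewrite fK.
Qed.
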